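(* Let $G=\mathbb Z_6\times\mathbb Z_2$. Then $\mathcal S(G)$ is exactly the union of the following sets of integers, where in each case $m$ runs through all integers: (a) (values divisible by $3^3$) $3^3(4m-1)$, $2^4\cdot 3^3(2m-1)$, $2^6\cdot 3^3 m$; (b) (values exactly divisible by $3^2$) $3^2(4m-1)p$, $2^4\cdot 3^2(2m-1)p$, $2^6\cdot 3^2 mp$ for a prime $p\equiv 7\pmod{12}$; and $2^8\cdot 3^2(4m-1)$, $2^{10}\cdot 3^2(4m-1)$, $2^{12}\cdot 3^2(2m-1)$, $2^{14}\cdot 3^2 m$; (c) (values coprime to $3$) $12m+1$, $2^4(6m+1)$, $2^6(3m+1)$; and $(12m+5)k$, $-2^4(6m+1)k$, $-2^6(3m+1)k$, where $k=p$ for a prime $p\in\mathcal P_1$, or $k=p^2$ for a prime $p\equiv 5\pmod{12}$, or $k=p_1p_2$ for primes $p_1,p_2\equiv 7\pmod{12}$; and $2^8(12m+5)$, $2^8(12m+5)p$, $2^{10}(12m+5)$, $2^{10}(12m+5)p$ for a prime $p\equiv 7\pmod{12}$; and $-2^{12}(6m+1)$, $-2^{14}(3m+1)$.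
   Context: For a finite group $G=\{g_1,\dots,g_n\}$, assign an independent variable $x_g$ to each $g\in G$; the group determinant $\mathscr D_G(x_{g_1},\dots,x_{g_n})$ is the determinant of the $n\times n$ matrix whose $(i,j)$ entry is $x_{g_ig_j^{-1}}$. Define $\mathcal S(G)=\{\mathscr D_G(x_{g_1},\dots,x_{g_n}) : x_{g_i}\in\mathbb Z\}$. Define $\mathcal P_1$ to be the set of primes $p\equiv 1\pmod{12}$ of the form $p=(6k+2)^2+(6t+3)^2$ for some integers $k,t$. (The remaining primes $p\equiv 1\pmod{12}$ are those of the form $(6k)^2+(6t+1)^2$.) *)

(* Defs.v *)
From HB Require Import structures.
From mathcomp Require Import all_boot all_order all_algebra all_fingroup.
From mathcomp Require Import classical_sets.

Set Implicit Arguments.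
Unset Strict Implicit.
Unset Printing Implicit Defensive.

Local Open Scope ring_scope.

(* [enum_val] enumerates the elements g_0, ..., g_(#|gT| - 1) of gT.  The
   determinant does not depend on the enumeration, since the same one indexes
   the rows and the columns. *)
Definition group_det (gT : finGroupType) (R : comNzRingType) (x : gT -> R) : R :=
  \det (\matrix_(i < #|gT|, j < #|gT|)
          x (enum_val i * (enum_val j)^-1)%g).

Definition group_det_values (gT : finGroupType) : set int :=
  range (@group_det gT int).

(* The group law that MathComp puts on 'Z_n is addition modulo n, and the one
   on a product type is componentwise. *)
Definition Z6xZ2 : finGroupType := ('Z_6 * 'Z_2)%type.

Definition P1 (p : nat) : Prop :=
  [/\ prime p, p = 1 %[mod 12]
    & exists k t : int, p%:Z = (6 * k + 2) ^+ 2 + (6 * t + 3) ^+ 2].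

Definition prime_mod12 (r p : nat) : Prop := prime p /\ p = r %[mod 12].

Definition admissible_k (k : nat) : Prop :=
  [\/ P1 k,
      exists2 p, prime_mod12 5 p & k = (p ^ 2)%N
    | exists p1 p2, [/\ prime_mod12 7 p1, prime_mod12 7 p2 & k = (p1 * p2)%N]].

(* Main.v *)
Require Import Defs.
From HB Require Import structures.
From mathcomp Require Import all_boot all_order all_algebra all_fingroup.
From mathcomp Require Import classical_sets.
From mathcomp Require Import finfield cyclic ring zify.

(* Write G as Z_3 x (Z_2 x Z_2).  Diagonalizing by characters turns the group
   determinant into the product, over the four characters of Z_2 x Z_2, of
   A_i * N(alpha_i) with A_i an integer and alpha_i in Z[w], w a primitive cube
   root of unity.  The quadruples that occur are those for which the A_i, and
   likewise the alpha_i, are congruent modulo 2 with sum divisible by 4, and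
   A_i = alpha_i modulo 1 - w.

   If the alpha_i are odd, one may multiply them by a power of w and assume
   alpha_i = 1 mod 2; then rho = prod alpha_i is 1 mod 4, and the value is
   (prod A_i) * N(rho) with rho = prod A_i modulo 1 - w.  A value that is 2
   mod 3 thus needs rho = 1 mod 4 and rho = -1 mod (1 - w), which forces
   a prime factor of rho to be nontrivial in (Z[w]/4)^*: inert primes 5 mod 12
   and the split primes of P1 have class -1, while primes 7 mod 12 have one of
   the other two nontrivial classes, so two of them are needed.  If the alpha_i
   are even, or if 3 divides the value exactly twice, only the residue of
   a norm modulo 12 matters, and a norm that is 7 mod 12 has a prime factor
   that is 7 mod 12.

   That P1 is the right set of split primes compares p = c^2 + 4 d^2 with
   p = X^2 + 12 w^2: setting U = (c + X) / 2 and V = (c - X) / 2 gives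
   U V = 3 w^2 - d^2, and Thue's lemma shows that an odd divisor of a primitive
   value of x^2 - 3 y^2 that is prime to 3 is 1 or -1 modulo 12. *)

Set Implicit Arguments.
Unset Strict Implicit.
Unset Printing Implicit Defensive.

Import GRing.Theory Num.Theory.

Local Open Scope ring_scope.

(** * Diagonalization by characters *)

(** Each column of [Q] is an eigenvector of the group matrix [M]. No inverse of [Q] over [R] is
    required: orthogonality makes [Q' *m Q] the scalar [n], and [n ^+ n] is cancelled from an
    equality of determinants. *)
Lemma group_det_characters (gT : finGroupType) (R : comNzRingType)
    (x : gT -> R) (chi : gT -> gT -> R) :
  (forall a, {morph chi a : g h / (g * h)%g >-> g * h}) ->
  (forall a b, \sum_g chi a g^-1%g * chi b g = #|gT|%:R *+ (a == b)) ->
  GRing.lreg (#|gT|%:R : R) ->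
  group_det x = \prod_a \sum_g x g * chi a g^-1%g.
Proof.
move=> chiM chi_orth reg_n; set n := #|gT| in reg_n *.
pose e (i : 'I_n) : gT := enum_val i.
have sum_e (F : gT -> R) : \sum_(i < n) F (e i) = \sum_g F g.
  by rewrite -big_enum_val.
pose M := \matrix_(i < n, j < n) x (e i * (e j)^-1)%g.
pose Q := \matrix_(i < n, a < n) chi (e a) (e i).
pose Q' := \matrix_(a < n, i < n) chi (e a) (e i)^-1%g.
pose d := \row_(a < n) \sum_g x g * chi (e a) g^-1%g.
have MQ : M *m Q = Q *m diag_mx d.
  apply/matrixP=> i a; rewrite mul_mx_diag !mxE.
  under eq_bigr do rewrite !mxE.
  rewrite (sum_e (fun h => x (e i * h^-1)%g * chi (e a) h)).
  rewrite mulrC big_distrl /=.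
  (* The summation variable becomes [g^-1 * e i], which turns the argument of [x] into [g]. *)
  rewrite (reindex_inj (inj_comp (mulIg (e i)) (@invg_inj gT))) /=.
  apply: eq_bigr => g _.
  by rewrite invMg invgK mulgA mulgV mul1g -mulrA -chiM.
have Q'Q : Q' *m Q = n%:R%:M.
  apply/matrixP=> a b; rewrite !mxE.
  under eq_bigr do rewrite !mxE.
  by rewrite (sum_e (fun h => chi (e a) h^-1%g * chi (e b) h)) chi_orth
             (inj_eq enum_val_inj).
have detQ'Q : \det Q' * \det Q = n%:R ^+ n by rewrite -det_mulmx Q'Q det_scalar.
have : \det Q' * (\det M * \det Q) = \det Q' * (\det Q * \det (diag_mx d)).
  by rewrite -!det_mulmx MQ.
rewrite mulrCA (mulrA _ _ (\det (diag_mx d))) detQ'Q mulrC.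
move/(lregX reg_n); rewrite /group_det => ->.
rewrite det_diag; under eq_bigr do rewrite mxE.
by rewrite -(big_enum_val (fun a => \sum_g x g * chi a g^-1%g)).
Qed.

(* [(a, b)] stands for [a + b w] with [w ^ 2 + w + 1 = 0].  Since [int * int]
   also carries the componentwise product ring, a literal pair has to be cast
   to [eis] before it is multiplied. *)
Definition eis : Type := (int * int)%type.
HB.instance Definition _ := GRing.Zmodule.copy eis (int * int)%type.

Definition eis_mul (x y : eis) : eis :=
  (x.1 * y.1 - x.2 * y.2, x.1 * y.2 + x.2 * y.1 - x.2 * y.2).

Fact eis_mulA : associative eis_mul.
Proof. by move=> [a b] [c d] [e f]; congr pair => /=; ring. Qed.
Fact eis_mulC : commutative eis_mul.
Proof. by move=> [a b] [c d]; congr pair => /=; ring. Qed.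
Fact eis_mul1 : left_id ((1, 0) : eis) eis_mul.
Proof. by move=> [a b]; congr pair => /=; ring. Qed.
Fact eis_mulDl : left_distributive eis_mul +%R.
Proof. by move=> [a b] [c d] [e f]; congr pair => /=; ring. Qed.
Fact eis_1_neq0 : ((1, 0) : eis) != 0. Proof. by []. Qed.

HB.instance Definition _ :=
  GRing.Zmodule_isComNzRing.Build eis eis_mulA eis_mulC eis_mul1 eis_mulDl eis_1_neq0.

Definition enorm (e : eis) : int := e.1 ^+ 2 - e.1 * e.2 + e.2 ^+ 2.

Lemma enorm_mul (x y : eis) : enorm (x * y) = enorm x * enorm y.
Proof. by case: x y => [a b] [c d]; rewrite /enorm /=; ring. Qed.

Lemma natr_eis k : (k%:R : eis) = (k%:Z, 0).
Proof. by elim: k => // k IH; rewrite -natr1 IH; congr pair => //=; lia. Qed.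

Lemma intr_eis (k : int) : (k%:~R : eis) = (k, 0).
Proof. by case: k => k; rewrite ?NegzE ?mulrNz -?pmulrn natr_eis. Qed.

(* [1 + w = - w ^ 2], a primitive sixth root of unity. *)
Definition zeta6 : eis := (1, 1).
Definition chi (a g : Z6xZ2) : eis := zeta6 ^+ (a.1 * g.1) * (-1) ^+ (a.2 * g.2).

Lemma chiM a : {morph chi a : g h / (g * h)%g >-> g * h}.
Proof.
have z6 : zeta6 ^+ 6 = 1 by [].
have z2 : (-1 : eis) ^+ 2 = 1 by [].
move=> g h; rewrite /chi /=.
rewrite -(expr_mod _ z6) -[X in _ * X](expr_mod _ z2) !modnMmr !expr_mod //.
by rewrite !mulnDr !exprD; ring.
Qed.

Lemma chi_orth a b : \sum_g chi a g^-1%g * chi b g = #|Z6xZ2|%:R *+ (a == b).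
Proof.
rewrite card_prod !card_ord.
rewrite -(pair_bigA _ (fun c d => chi a (c, d)^-1%g * chi b (c, d))) /=.
rewrite !big_ord_recl !big_ord0 /=.
case: a b => [[a la] [b lb]] [[a' la'] [b' lb']].
(* All pairs of characters are made explicit, and each sum is evaluated. *)
do 6?[case: a la => [|a] la //]; do 2?[case: b lb => [|b] lb //];
do 6?[case: a' la' => [|a'] la' //]; do 2?[case: b' lb' => [|b'] lb' //].
Qed.

Lemma big_Z6xZ2 (R : Type) (idx : R) (op : Monoid.com_law idx) (F : Z6xZ2 -> R) :
  \big[op/idx]_a F a =
  \big[op/idx]_(0 <= c < 6) \big[op/idx]_(0 <= d < 2) F (inZp c, inZp d).
Proof.
rewrite (eq_bigr (fun a : Z6xZ2 => F (a.1, a.2))); last by case.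
transitivity (\big[op/idx]_(c : 'Z_6) \big[op/idx]_(d : 'Z_2) F (c, d)).
  exact: (esym (pair_bigA _ (fun c d => F (c, d)))).
rewrite big_mkord; apply: eq_bigr => c _; rewrite big_mkord.
by apply: eq_bigr => d _; rewrite !valZpK.
Qed.

(** Cancellation of 12 is checked on coordinates, so [eis] need not be made an integral domain. *)
Lemma lreg_card_Z6xZ2 : GRing.lreg (#|Z6xZ2|%:R : eis).
Proof.
have natr_mulE k (e : eis) : k%:R * e = (k%:Z * e.1, k%:Z * e.2).
  by rewrite natr_eis; case: e => a b; congr pair => /=; ring.
rewrite card_prod !card_ord -[(_ * _)%N]/12%N => [[a b] [c d]].
rewrite !natr_mulE /=.
by move=> [h1 h2]; congr pair; lia.
Qed.

Definition fourier (y : nat -> nat -> int) (a : Z6xZ2) : eis :=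
  \sum_(0 <= c < 6) \sum_(0 <= d < 2) (y c d)%:~R * chi a (inZp c, inZp d)^-1%g.

(* The part of the character sum over Z_2 x Z_2 (signs [s] and [t]) that lies
   over [j] in Z_3: the first coordinate is [j] or [3 + j] modulo 6. *)
Definition z3_sum (y : nat -> nat -> int) (s t : int) (j : nat) : int :=
  s ^+ j * (y j 0%N + t * y j 1%N + s * (y (3 + j)%N 0%N + t * y (3 + j)%N 1%N)).

Definition z3_trivial y s t : int := z3_sum y s t 0 + z3_sum y s t 1 + z3_sum y s t 2.
(** The sum over [j] of [z3_sum y s t j] times [w ^ j], reduced by [w ^ 2 = - 1 - w]. *)
Definition z3_omega y s t : eis :=
  (z3_sum y s t 0 - z3_sum y s t 2, z3_sum y s t 1 - z3_sum y s t 2).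

Definition econj (e : eis) : eis := (e.1 - e.2, - e.2).

Lemma intr_mulE (k : int) (e : eis) : k%:~R * e = (k * e.1, k * e.2).
Proof. by rewrite intr_eis; case: e => a b; congr pair => /=; ring. Qed.

Ltac fourier_tac := rewrite /fourier /index_iota /= !big_cons !big_nil;
  repeat match goal with |- context[chi ?a ?g] => let v := eval vm_compute in (chi a g) in
  replace (chi a g) with v by (vm_compute; reflexivity) end;
  rewrite !intr_mulE; congr pair; rewrite /= ?expr0 ?expr1; ring.

Lemma fourier_trivial y (a b : bool) :
  fourier y (inZp (3 * a), inZp b) = (z3_trivial y ((-1) ^+ a) ((-1) ^+ b), 0).
Proof. case: a; case: b; rewrite /z3_trivial /z3_sum; fourier_tac. Qed.

(** For first coordinates 4 and 1 the inverse of the generator of Z_6 is sent to [w] and [- w],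
    because [zeta6 ^ 2 = w] and [zeta6 ^ 5 = - w]. *)
Lemma fourier_omega y (a b : bool) :
  fourier y (inZp (4 - 3 * a), inZp b) = z3_omega y ((-1) ^+ a) ((-1) ^+ b).
Proof. case: a; case: b; rewrite /z3_omega /z3_sum; fourier_tac. Qed.

Lemma fourier_omega2 y (a b : bool) :
  fourier y (inZp (2 + 3 * a), inZp b) = econj (z3_omega y ((-1) ^+ a) ((-1) ^+ b)).
Proof. case: a; case: b; rewrite /econj /z3_omega /z3_sum; fourier_tac. Qed.

Lemma mul_econj e : e * econj e = (enorm e)%:~R.
Proof. by case: e => u v; rewrite intr_eis /enorm; congr pair => /=; ring. Qed.

(** For each pair of signs there are three characters: one trivial on Z_3, and two conjugate ones
    whose factors multiply to a norm. *)
Lemma group_det_Z6xZ2 (x : Z6xZ2 -> int) (y := fun c d => x (inZp c, inZp d)) :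
  group_det x = \prod_(a : bool) \prod_(b : bool)
    (z3_trivial y ((-1) ^+ a) ((-1) ^+ b) * enorm (z3_omega y ((-1) ^+ a) ((-1) ^+ b))).
Proof.
suff: (group_det x)%:~R = (\prod_(a : bool) \prod_(b : bool)
    (z3_trivial y ((-1) ^+ a) ((-1) ^+ b) * enorm (z3_omega y ((-1) ^+ a) ((-1) ^+ b))))%:~R
    :> eis.
  by rewrite !intr_eis => /(congr1 fst).
have -> : (group_det x)%:~R = group_det (fun g => (x g)%:~R) :> eis.
  by rewrite /group_det -det_map_mx; congr (\det _); apply/matrixP=> i j; rewrite !mxE.
rewrite (group_det_characters _ chiM chi_orth lreg_card_Z6xZ2).
under eq_bigr => a _ do rewrite big_Z6xZ2 -/(fourier y a).
transitivity (\prod_(a : bool) \prod_(b : bool)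
   (fourier y (inZp (3 * a), inZp b) *
    (fourier y (inZp (4 - 3 * a), inZp b) * fourier y (inZp (2 + 3 * a), inZp b)))).
  rewrite big_Z6xZ2 /index_iota /= !big_cons !big_nil !big_bool /=.
  ring.
rewrite rmorph_prod; apply: eq_bigr => a _; rewrite rmorph_prod; apply: eq_bigr => b _.
by rewrite fourier_trivial fourier_omega fourier_omega2 mul_econj rmorphM -intr_eis.
Qed.

(* Describes the character values of an integer function on Z_2 x Z_2. *)
Definition klein (a b c d : int) : Prop :=
  [/\ (2 %| a - b)%Z, (2 %| a - c)%Z, (2 %| a - d)%Z & (4 %| a + b + c + d)%Z].

(** Fourier inversion on Z_2 x Z_2; the congruences make the four divisions by 4 exact. *)
Lemma klein_transform a b c d : klein a b c d -> exists p q r s : int,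
  [/\ a = p + q + r + s, b = p - q + r - s, c = p + q - r - s & d = p - q - r + s].
Proof.
move=> [ab ac ad abcd].
exists ((a + b + c + d) %/ 4)%Z, ((a - b + c - d) %/ 4)%Z, ((a + b - c - d) %/ 4)%Z,
  ((a - b - c + d) %/ 4)%Z.
by split; lia.
Qed.

(** Since [w = 1] modulo [1 - w], the residue of [e] is [e.1 + e.2] modulo 3, which gives the
    conditions on [a - e.1 - e.2] and its analogues. *)
Definition Z6xZ2_rep (n : int) : Prop :=
  exists (a b c d : int) (e f g h : eis),
    [/\ klein a b c d, klein e.1 f.1 g.1 h.1, klein e.2 f.2 g.2 h.2,
       [/\ (3 %| a - e.1 - e.2)%Z, (3 %| b - f.1 - f.2)%Z,
           (3 %| c - g.1 - g.2)%Z & (3 %| d - h.1 - h.2)%Z]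
     & n = a * b * c * d * (enorm e * enorm f * enorm g * enorm h)].

Lemma group_det_values_Z6xZ2 (n : int) : group_det_values Z6xZ2 n <-> Z6xZ2_rep n.
Proof.
split=> [[x _ <-]|].
  rewrite group_det_Z6xZ2 !big_bool /=; set y := fun c d => _.
  exists (z3_trivial y (-1) (-1)), (z3_trivial y (-1) 1), (z3_trivial y 1 (-1)), (z3_trivial y 1 1).
  exists (z3_omega y (-1) (-1)), (z3_omega y (-1) 1), (z3_omega y 1 (-1)), (z3_omega y 1 1).
  by split; [..|by rewrite ?expr0 ?expr1; ring];
    rewrite /klein /z3_trivial /z3_omega /z3_sum /= ?expr0 ?expr1;
    split; clearbody y; lia.
move=> [a [b [c [d [[e e'] [[f f'] [[g g'] [[h h'] /= []]]]]]]]].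
have shape (x y z : int) : (3 %| x - y - z)%Z -> exists k, x = y + z + 3 * k.
  by case/dvdzP=> k Hk; exists k; lia.
move=> ka ke ke' [/shape[i ai] /shape[j bj] /shape[k ck] /shape[l dl]] ->.
(* Inversion over Z_3: a trivial sum [e + e' + 3 * i] and an element [(e, e')] come from the parts
   [e + i], [e' + i] and [i]. Each part is then inverted over Z_2 x Z_2. In the second one, the
   factor [s ^+ j] of [z3_sum] changes the sign where [s = -1]. *)
subst a b c d.
have [|p0 [q0 [r0 [s0 [E0 F0 G0 H0]]]]] := @klein_transform
  (e + i) (f + j) (g + k) (h + l).
  by case: ka ke ke' => ? ? ? ? [? ? ? ?] [? ? ? ?]; split; lia.
have [|p1 [q1 [r1 [s1 [E1 F1 G1 H1]]]]] := @klein_transform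
  (e' + i) (f' + j) (- (g' + k)) (- (h' + l)).
  by case: ka ke ke' => ? ? ? ? [? ? ? ?] [? ? ? ?]; split; lia.
have [|p2 [q2 [r2 [s2 [E2 F2 G2 H2]]]]] := @klein_transform i j k l.
  by case: ka ke ke' => ? ? ? ? [? ? ? ?] [? ? ? ?]; split; lia.
exists (fun g : Z6xZ2 =>
  nth 0 [:: p0; q0; p1; q1; p2; q2; r0; s0; r1; s1; r2; s2] (2 * g.1 + g.2)) => //.
rewrite group_det_Z6xZ2 !big_bool /= !expr0 !expr1; set y := fun c d => _.
have -> : z3_trivial y 1 1 = e + e' + 3 * i by rewrite /z3_trivial /z3_sum /y /=; lia.
have -> : z3_trivial y 1 (-1) = f + f' + 3 * j by rewrite /z3_trivial /z3_sum /y /=; lia.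
have -> : z3_trivial y (-1) 1 = g + g' + 3 * k by rewrite /z3_trivial /z3_sum /y /=; lia.
have -> : z3_trivial y (-1) (-1) = h + h' + 3 * l by rewrite /z3_trivial /z3_sum /y /=; lia.
have -> : z3_omega y 1 1 = (e, e') by rewrite /z3_omega /z3_sum /y /=; congr pair; lia.
have -> : z3_omega y 1 (-1) = (f, f') by rewrite /z3_omega /z3_sum /y /=; congr pair; lia.
have -> : z3_omega y (-1) 1 = (g, g') by rewrite /z3_omega /z3_sum /y /=; congr pair; lia.
have -> : z3_omega y (-1) (-1) = (h, h') by rewrite /z3_omega /z3_sum /y /=; congr pair; lia.
by ring.
Qed.

(** * Thue's lemma and quadratic residues *)

Lemma Fp_prim_root p d : prime p -> (d %| p.-1)%N ->
  exists z : 'F_p, d.-primitive_root z.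
Proof.
move=> p_pr d_dvd.
have p1_gt0 : (0 < p.-1)%N by have := prime_gt1 p_pr; lia.
pose rs := enum [pred x : 'F_p | x != 0].
have size_rs : size rs = p.-1.
  by rewrite -cardE cardC1 card_Fp.
have rs1 : all p.-1.-unity_root rs.
  apply/allP => x; rewrite mem_enum inE /= => x0; apply/unity_rootP.
  have := expf_card x; rewrite card_Fp // => xp; apply: (mulfI x0).
  by rewrite -exprS (ltn_predK (prime_gt1 p_pr)) xp mulr1.
have /hasP[z _ zP] := has_prim_root p1_gt0 rs1 (enum_uniq _) (eq_leq (esym size_rs)).
by exists (z ^+ (p.-1 %/ d)); apply: dvdn_prim_root.
Qed.

(** Pigeonhole: with [s] the integer square root of [n], the box of pairs from 0 to [s] has more
    than [n] points, so [i - t * j] repeats modulo [n]; the difference of two such points is the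
    solution. *)
Lemma thue (n : nat) (t : int) : (0 < n)%N ->
  exists x y : int, [/\ (n %| x - t * y)%Z, (x != 0) || (y != 0), x ^+ 2 <= n & y ^+ 2 <= n].
Proof.
move=> n_gt0.
have [s /andP[s_le s_gt]] : exists s, (s ^ 2 <= n < s.+1 ^ 2)%N.
  elim: n {n_gt0} => [|n [s /andP[s_le s_gt]]]; first by exists 0%N.
  have [lt|ge] := ltnP n.+1 (s.+1 ^ 2).
    by exists s; rewrite lt andbT; lia.
  by exists s.+1; rewrite ge /=; nia.
have n_neq0 : n%:Z != 0 by lia.
pose g (ij : 'I_s.+1 * 'I_s.+1) := ((ij.1%:Z - t * ij.2%:Z) %% n)%Z.
have g_lt ij : (`|g ij| < n)%N.
  by have := modz_ge0 (ij.1%:Z - t * ij.2%:Z) n_neq0;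
     have := ltz_mod (ij.1%:Z - t * ij.2%:Z) n_neq0; rewrite -/(g ij); lia.
pose f ij := Ordinal (g_lt ij).
have /injectivePn[[i j] [[k l] neq eq_f]] : ~~ injectiveb f.
  apply/negP => /injectiveP /leq_card.
  by rewrite card_prod !card_ord; nia.
exists (i%:Z - k%:Z), (j%:Z - l%:Z).
have [/= i_lt j_lt k_lt l_lt] := And4 (ltn_ord i) (ltn_ord j) (ltn_ord k) (ltn_ord l).
split; [| |nia|nia].
  have : g (i, j) = g (k, l).
    move/(congr1 val): eq_f => /=.
    have := modz_ge0 (i%:Z - t * j%:Z) n_neq0.
    have := modz_ge0 (k%:Z - t * l%:Z) n_neq0.
    by rewrite /g /=; lia.
  move/eqP; rewrite /g /= eqz_mod_dvd.
  by congr (_ %| _)%Z; ring.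
apply: contraNT neq; rewrite negb_or !negbK !subr_eq0 => /andP[/eqP ik /eqP jl].
by apply/eqP; congr pair; apply: val_inj => /=; lia.
Qed.

Lemma Fp_dvdz p (k : int) : prime p -> (p %| k)%Z = (k%:~R == 0 :> 'F_p).
Proof. by move=> p_pr; rewrite (dvdz_pcharf (pchar_Fp p_pr)). Qed.

(** An element of order 4 in the multiplicative group squares to -1. *)
Lemma prime_sqrt_opp1 p : prime p -> p = 1 %[mod 4] -> exists t : int, (p %| t ^+ 2 + 1)%Z.
Proof.
move=> p_pr p1.
have [|z zP] := @Fp_prim_root p 4 p_pr; first by have := prime_gt1 p_pr; lia.
exists (val z)%:Z.
have z2 : z ^+ 2 = -1.
  have : (z ^+ 2) ^+ 2 == 1 by rewrite -exprM (prim_expr_order zP).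
  rewrite sqrf_eq1 => /orP[|/eqP //].
  by rewrite -(prim_order_dvd zP).
rewrite (Fp_dvdz _ p_pr).
by rewrite rmorphD rmorphXn /= -pmulrn natr_Zp z2 addNr.
Qed.

(** If [z] is a primitive cube root of unity, then [2 * z + 1] squares to -3. *)
Lemma prime_sqrt_opp3 p : prime p -> p = 1 %[mod 3] -> exists t : int, (p %| t ^+ 2 + 3)%Z.
Proof.
move=> p_pr p1.
have [|z zP] := @Fp_prim_root p 3 p_pr; first by have := prime_gt1 p_pr; lia.
exists (2 * (val z)%:Z + 1).
have z1 : z - 1 != 0 by rewrite subr_eq0 -(expr1 z) -(prim_order_dvd zP).
have z2 : z ^+ 2 + z + 1 = 0.
  apply: (mulfI z1); transitivity (z ^+ 3 - 1); first by ring.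
  by rewrite (prim_expr_order zP) subrr mulr0.
rewrite (Fp_dvdz _ p_pr).
rewrite rmorphD rmorphXn rmorphD rmorphM /= -pmulrn natr_Zp; apply/eqP.
by transitivity (4 * (z ^+ 2 + z + 1)); [ring|rewrite z2 mulr0].
Qed.

(** The hypothesis gives [a ^+ 3 = (- b) ^+ 3] in ['F_p]. With [p = 3 k + 2], Fermat reads
    [x = (x ^+ 3) ^+ k * x ^+ 2], from which [a * b * (a + b) = 0]; whichever factor vanishes, both
    [a] and [b] do. *)
Lemma prime_inert p (a b : int) : prime p -> p = 2 %[mod 3] ->
  (p %| a ^+ 2 - a * b + b ^+ 2)%Z -> (p %| a)%Z /\ (p %| b)%Z.
Proof.
move=> p_pr p2; rewrite !(Fp_dvdz _ p_pr).
rewrite rmorphD rmorphB !rmorphXn rmorphM /=.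
move: (a%:~R) (b%:~R) => {a b} a b /eqP ab0.
have ab3 : a ^+ 3 = (- b) ^+ 3.
  apply/eqP; rewrite -subr_eq0; apply/eqP.
  by transitivity ((a + b) * (a ^+ 2 - a * b + b ^+ 2)); [ring|rewrite ab0 mulr0].
have FermatE (x : 'F_p) : x = (x ^+ 3) ^+ (p %/ 3) * x ^+ 2.
  have := expf_card x; rewrite card_Fp // => {1}<-.
  by rewrite -exprM -exprD; congr (_ ^+ _); have := divn_eq p 3; rewrite mulnC p2.
have three : 3%:R != 0 :> 'F_p.
  rewrite -(dvdn_pcharf (pchar_Fp p_pr)) dvdn_prime2 //.
  by apply: contra_eq_neq p2 => ->.
have : a * b * (a + b) = 0.
  transitivity (a * (- b) ^+ 2 - (- b) * a ^+ 2); first by ring.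
  have -> : a * (- b) ^+ 2 = (a ^+ 3) ^+ (p %/ 3) * a ^+ 2 * (- b) ^+ 2 by rewrite -FermatE.
  have -> : - b * a ^+ 2 = (a ^+ 3) ^+ (p %/ 3) * (- b) ^+ 2 * a ^+ 2 by rewrite ab3 -FermatE.
  by rewrite mulrAC subrr.
move/eqP; rewrite !mulf_eq0 -orbA => /or3P[] /eqP h.
- move: ab0; rewrite h mul0r expr0n sub0r oppr0 add0r => /eqP.
  by rewrite sqrf_eq0 => ->; rewrite eqxx.
- move: ab0; rewrite h mulr0 expr0n subr0 addr0 => /eqP.
  by rewrite sqrf_eq0 => ->; rewrite eqxx.
move/(canRL (addrK _)): h ab0; rewrite sub0r => -> ab0.
have /eqP : 3%:R * b ^+ 2 = 0 by rewrite -ab0; ring.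
by rewrite mulf_eq0 (negPf three) sqrf_eq0 => /= /eqP ->; rewrite oppr0 eqxx.
Qed.

Lemma prime_dvdzX p (a : int) : prime p -> (p %| a ^+ 2)%Z = (p %| a)%Z.
Proof. by move=> p_pr; rewrite !dvdzE abszX Euclid_dvdX // andbT. Qed.

(** A single list that serves arguments modulo 3, 4, 8 and 12. *)
Lemma sqrz_mod24 (x : int) : ((x ^+ 2) %% 24)%Z \in [:: 0; 1; 4; 9; 12; 16].
Proof.
rewrite -modzXm; have := modz_ge0 x (isT : (24 : int) != 0).
have := ltz_mod x (isT : (24 : int) != 0).
by case: (x %% 24)%Z => // n; do 24?[case: n => [|n] //].
Qed.

(** The exponent of 3 would be even on the left and odd on the right. *)
Lemma sqr_eq_3sqr (x y : int) : x ^+ 2 = 3 * y ^+ 2 -> y = 0.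
Proof.
move=> xy; apply/eqP/negP => /negP y0.
have yn0 : (0 < `|y|)%N by lia.
have xn0 : (0 < `|x|)%N by nia.
have : (`|x| ^ 2 = 3 * `|y| ^ 2)%N by nia.
by move/(congr1 (logn 3)); rewrite lognM ?expn_gt0 ?yn0 // !lognX (_ : logn 3 3 = 1%N) //; lia.
Qed.

Lemma mod12_of_norm (n : nat) (x y : int) : odd n -> ~~ (3 %| n)%N ->
  x ^+ 2 - 3 * y ^+ 2 = n -> n = 1 %[mod 12].
Proof.
move=> n_odd n3 xy.
have := sqrz_mod24 x; have := sqrz_mod24 y; rewrite !inE; lia.
Qed.

(** Thue's lemma yields [X ^+ 2 - 3 * Y ^+ 2 = k * n] with [-3 <= k <= 1], and [k] is not 0 as 3 is
    not a square of a rational. Each of the four remaining [k] fixes [n] modulo 12. *)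
Lemma thue_norm (n : nat) (x y : int) : odd n -> ~~ (3 %| n)%N ->
  (n %| x ^+ 2 - 3 * y ^+ 2)%Z -> coprimez n y -> n = 1 %[mod 12] \/ n = 11 %[mod 12].
Proof.
move=> n_odd n3 nxy /coprimezP[[u v] /= uv].
have n_gt0 : (0 < n)%N by lia.
(* [v] inverts [y] modulo [n], so [x * v] is a square root of 3 modulo [n]. *)
have [X [Y [nXY XY0 X_le Y_le]]] := thue (x * v) n_gt0.
have /dvdzP[k kE] : (n %| X ^+ 2 - 3 * Y ^+ 2)%Z.
  have -> : X ^+ 2 - 3 * Y ^+ 2 = (X + x * v * Y) * (X - x * v * Y) +
      v ^+ 2 * Y ^+ 2 * (x ^+ 2 - 3 * y ^+ 2) - 3 * Y ^+ 2 * (1 + v * y) * u * n%:Z.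
    rewrite -!mulrA [u * _](_ : _ = 1 - v * y); last by rewrite -uv; ring.
    by ring.
  by rewrite rpredB ?rpredD ?dvdz_mull.
have sX := sqrz_mod24 X; have sY := sqrz_mod24 Y; rewrite !inE in sX sY.
have [k_ge k_le] : -3 <= k /\ k <= 1.
  have := sqr_ge0 X; have := sqr_ge0 Y.
  move: (X ^+ 2) (Y ^+ 2) X_le Y_le kE => a b a_le b_le kE b_ge a_ge.
  by clear -a_le b_le kE b_ge a_ge n_gt0; split; nia.
have k_neq0 : k <> 0.
  move=> k0; move: kE; rewrite k0 mul0r => /(canRL (subrK _)); rewrite add0r.
  move=> XY; have Y0 := sqr_eq_3sqr XY; have X0 : X = 0 by apply/eqP; rewrite -sqrf_eq0 XY Y0.
  by rewrite X0 Y0 in XY0.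
clear -n_odd n3 kE sX sY k_ge k_le k_neq0.
have [k1|[k1|[k1|k1]]] : k = 1 \/ k = -1 \/ k = -2 \/ k = -3.
  by clear -k_ge k_le k_neq0; lia.
- by left; apply: (mod12_of_norm n_odd n3 (x := X) (y := Y)); rewrite kE k1 mul1r.
- by right; subst k; lia.
- by left; subst k; lia.
(* For [k = -3], dividing by -3 exchanges the two squares and leaves [Y ^+ 2 - 3 * X' ^+ 2 = n]. *)
- left; subst k; have /dvdzP[X' XE] : (3 %| X)%Z.
    have : (3 %| X ^+ 2)%Z by lia.
    by rewrite (prime_dvdzX _ (isT : prime 3)).
  apply: (mod12_of_norm n_odd n3 (x := Y) (y := X')) => //.
  by rewrite XE exprMn in kE; clear -kE; lia.
Qed.

(** * The primes in P1 *)

Lemma sqr_prime_mod12 (p : nat) : odd p -> ~~ (3 %| p)%N -> (p ^ 2 = 1 %[mod 12])%N.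
Proof.
move=> p_odd p3; have := sqrz_mod24 p; rewrite !inE -mulnn.
have p2_odd : odd (p * p) by rewrite oddM p_odd.
have p2_3 : ~~ (3 %| p * p)%N by rewrite Euclid_dvdM // orbb.
by have : p%:Z ^+ 2 = (p * p)%N by []; lia.
Qed.

(** A form of primitivity that survives the descents below: a common prime of [x] and [y] is allowed
    when it misses [n] or [m]. *)
Definition no_common_prime (n : nat) (m x y : int) : Prop := forall q, prime q ->
  (q %| n)%N -> (q %| m)%Z -> (q %| x)%Z -> (q %| y)%Z -> False.

(** When [n] is coprime to [y] this is [thue_norm]. Otherwise a common prime [q] of [n] and [y]
    divides [x] but not [m], so [q ^ 2] divides [n]; removing it keeps [n] modulo 12. *)
Lemma divisor_of_norm (n : nat) (m x y : int) : odd n -> ~~ (3 %| n)%N ->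
  n%:Z * m = x ^+ 2 - 3 * y ^+ 2 -> no_common_prime n m x y ->
  n = 1 %[mod 12] \/ n = 11 %[mod 12].
Proof.
elim/ltn_ind: n m x y => n IH m x y n_odd n3 nm prim.
have [cop|ncop] := boolP (coprimez n y).
  by apply: (thue_norm (x := x) n_odd n3 _ cop); rewrite -nm dvdz_mulr.
have [q q_pr /andP[q_n q_y]] : exists2 q, prime q & (q %| n)%N && (q %| y)%Z.
  exists (pdiv (gcdn n `|y|)).
    by apply: pdiv_prime; move: ncop (gcdn_gt0 n `|y|); rewrite /coprimez /gcdz /=; lia.
  by rewrite /dvdz /= -dvdn_gcd pdiv_dvd.
have q_x : (q %| x)%Z.
  rewrite -(prime_dvdzX _ q_pr) -(subrK (3 * y ^+ 2) (x ^+ 2)) -nm.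
  by apply: rpredD; [apply: dvdz_mulr|apply: dvdz_mull; rewrite prime_dvdzX].
have q_m : ~~ (q %| m)%Z by apply/negP => q_m; apply: (prim q).
have q2_n : (q ^ 2 %| n)%N.
  have : (q ^ 2 %| n * `|m|)%N.
    suff : (q%:Z ^+ 2 %| n%:Z * m)%Z by rewrite dvdzE abszM abszX.
    by rewrite nm; apply: rpredB; [|apply: dvdz_mull]; apply: dvdz_exp2r.
  by rewrite Gauss_dvdl // coprimeXl // prime_coprime.
have [n' nE] := dvdnP q2_n.
have /dvdzP[x' xE] := q_x; have /dvdzP[y' yE] := q_y.
have q_odd : odd q by move: n_odd; rewrite nE oddM oddX /= => /andP[].
have q3 : ~~ (3 %| q)%N by apply: contraNN n3 => q3; rewrite nE dvdn_mull // dvdn_exp.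
have q_gt1 := prime_gt1 q_pr.
have [|||||n1|n1] := IH n' _ m x' y'.
- rewrite [X in (_ < X)%N]nE ltn_Pmulr ?(ltn_exp2l 0) //.
  by move: n_odd; rewrite nE oddM; case: n' {nE}.
- by move: n_odd; rewrite nE oddM => /andP[].
- by apply: contraNN n3; rewrite nE => h; rewrite dvdn_mulr.
- have q2_neq0 : (q%:Z ^+ 2) != 0 by rewrite expf_neq0 //; lia.
  apply: (mulfI q2_neq0); transitivity (n%:Z * m).
    by rewrite nE -mulnn !PoszM; ring.
  by rewrite nm xE yE; ring.
- move=> r r_pr rn rm rx ry; apply: (prim r); rewrite // ?nE ?xE ?yE ?dvdz_mulr //.
  by rewrite dvdn_mulr.
- by left; rewrite nE -modnMm n1 sqr_prime_mod12.
- by right; rewrite nE -modnMm n1 sqr_prime_mod12.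
Qed.

(** If 3 does not divide [n], then [n * m] is 1 modulo 3, so [n] and [m] agree modulo 3, and for [n]
    equal to 1 or 11 modulo 12 the residues modulo 3 and 4 determine each other. If [n = 3 * n'],
    then [n' * (- m) = y ^+ 2 - 3 * x' ^+ 2], and passing from [n] to [n'] and from [m] to [- m]
    flips both sides of the claim. *)
Lemma divisor_of_norm_mod4 (n : nat) (m x y : int) : odd n -> ~~ (3 %| m)%Z ->
  n%:Z * m = x ^+ 2 - 3 * y ^+ 2 -> no_common_prime n m x y ->
  (n %% 4 == 1)%N = ((m %% 3)%Z == 1).
Proof.
elim/ltn_ind: n m x y => n IH m x y n_odd m3 nm prim.
have [n3|n3] := boolP (3 %| n)%N; last first.
  have := divisor_of_norm n_odd n3 nm prim.
  have : ((n%:Z * m) %% 3)%Z = 0 \/ ((n%:Z * m) %% 3)%Z = 1.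
    by have := sqrz_mod24 x; rewrite nm !inE; lia.
  have := modzMm n m 3.
  have [|] : (n%:Z %% 3)%Z = 1 \/ (n%:Z %% 3)%Z = 2 by clear -n3; lia.
    move=> n31; rewrite n31.
    have [|] : (m %% 3)%Z = 1 \/ (m %% 3)%Z = 2 by clear -m3; lia.
      by move=> ->; move: n31; clear; lia.
    by move=> ->; move: n31; clear; lia.
  move=> n32; rewrite n32.
  have [|] : (m %% 3)%Z = 1 \/ (m %% 3)%Z = 2 by clear -m3; lia.
    by move=> ->; move: n32; clear; lia.
  by move=> ->; move: n32; clear; lia.
have [n' nE] := dvdnP n3.
have x3 : (3 %| x)%Z by rewrite -(prime_dvdzX _ (isT : prime 3)); lia.
have /dvdzP[x' xE] := x3.
have e : (n' %% 4 == 1)%N = ((- m %% 3)%Z == 1).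
  apply: (IH n' _ (- m) y x').
  - by lia.
  - by move: n_odd; rewrite nE oddM => /andP[].
  - by lia.
  - by move: nm; rewrite nE xE PoszM exprMn; clear; lia.
  - move=> q q_pr q_n' q_m q_y q_x'; apply: (prim q) => //.
    + by rewrite nE dvdn_mulr.
    + by rewrite rpredN in q_m.
    + by rewrite xE dvdz_mulr.
by clear -e nE n_odd m3; lia.
Qed.

Lemma sqrz_mod4 (x : int) : ((x ^+ 2) %% 4)%Z = (x %% 2)%Z.
Proof.
rewrite -modzXm; have := modz_ge0 x (isT : (4 : int) != 0).
have := ltz_mod x (isT : (4 : int) != 0).
have -> : (x %% 2)%Z = ((x %% 4)%Z %% 2)%Z by lia.
by case: (x %% 4)%Z => // n; do 4?[case: n => [|n] //].
Qed.

(** Modulo 4 one has [V = 2 * w], so the right side says that [U] is 3 modulo 4. As [U - V] is 1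
    modulo 3, the left side says that [U] is 2 modulo 3. The link is that [U] divides
    [d ^+ 2 - 3 * w ^+ 2]: [divisor_of_norm] settles [U] prime to 3, and [divisor_of_norm_mod4] the
    case where 3 divides [U]. *)
Lemma quadratic_forms_mod4_odd (p : nat) (U V d w : int) : prime p ->
  p%:Z = (U + V) ^+ 2 + 4 * d ^+ 2 -> p%:Z = (U - V) ^+ 2 + 12 * w ^+ 2 ->
  (U %% 2)%Z = 1 -> (V %% 2)%Z = 0 -> ((U - V) %% 3)%Z = 1 ->
  (3 %| U + V)%Z = (((U - V + 2 * w) %% 4)%Z == 3).
Proof.
move=> p_pr pc pX U2 V2 UV3.
have UV : - (U * V) = d ^+ 2 - 3 * w ^+ 2 by clear -pc pX; lia.
(* A prime dividing [U], [V] and [d] would have its square dividing [p]. *)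
have prim m : (m == V) || (m == - V) -> no_common_prime `|U| m d w.
  move=> mV q q_pr q_U q_m q_d _.
  have q_V : (q %| V)%Z by case/orP: mV q_m => /eqP ->; rewrite ?rpredN.
  have : (q%:Z ^+ 2 %| p%:Z)%Z.
    rewrite pc; apply: rpredD; last by apply: dvdz_mull; apply: dvdz_exp2r.
    by apply: dvdz_exp2r; apply: rpredD.
  rewrite dvdzE abszX /= => q2_p.
  have qp : q = p.
    by apply/eqP; rewrite -dvdn_prime2 //; apply: dvdn_trans q2_p; apply: dvdn_exp.
  move: q2_p (prime_gt1 p_pr); rewrite qp -{2}(expn1 p) => h p_gt1.
  by move: h; rewrite dvdn_Pexp2l.
have wd : (V %% 4)%Z = (2 * w %% 4)%Z.
  have dE := sqrz_mod4 d; have wE := sqrz_mod4 w.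
  have UV4 : ((U * V) %% 4)%Z = (V %% 4)%Z.
    have [u uE] : exists u, U = 2 * u + 1 by exists (U %/ 2)%Z; lia.
    have [v vE] : exists v, V = 2 * v by exists (V %/ 2)%Z; lia.
    have -> : U * V = V + 4 * (u * v) by rewrite uE vE; ring.
    by lia.
  clear -dE wE UV UV4 V2; move: (U * V) (d ^+ 2) (w ^+ 2) dE wE UV UV4 => a b c *; lia.
have nU_odd : odd `|U| by lia.
have [U0|U0] : 0 <= U \/ U < 0 by lia.
  have nUV : `|U|%:Z * (- V) = d ^+ 2 - 3 * w ^+ 2 by rewrite gez0_abs // mulrN.
  have P := prim (- V) (introT orP (or_intror (eqxx _))).
  have D1 n3 := divisor_of_norm nU_odd n3 nUV P.
  have D2 m3 := divisor_of_norm_mod4 nU_odd m3 nUV P.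
  by clear -D1 D2 UV3 wd U0 nU_odd V2; lia.
have nUV : `|U|%:Z * V = d ^+ 2 - 3 * w ^+ 2 by rewrite ltz0_abs // mulNr.
have P := prim V (introT orP (or_introl (eqxx _))).
have D1 n3 := divisor_of_norm nU_odd n3 nUV P.
have D2 m3 := divisor_of_norm_mod4 nU_odd m3 nUV P.
by clear -D1 D2 UV3 wd U0 nU_odd V2; lia.
Qed.

Lemma quadratic_forms_mod4 (p : nat) (c d X w : int) : prime p -> odd p ->
  p%:Z = c ^+ 2 + 4 * d ^+ 2 -> p%:Z = X ^+ 2 + 12 * w ^+ 2 -> (X %% 3)%Z = 1 ->
  (3 %| c)%Z = (((X + 2 * w) %% 4)%Z == 3).
Proof.
move=> p_pr p_odd pc pX X3.
have cE := sqrz_mod4 c; have XE := sqrz_mod4 X.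
have c_odd : (c %% 2)%Z = 1 by clear -p_odd pc cE; lia.
have X_odd : (X %% 2)%Z = 1 by clear -p_odd pX XE; lia.
have [U UE] : exists U, c + X = 2 * U by exists ((c + X) %/ 2)%Z; lia.
have [U2|U2] : (U %% 2)%Z = 1 \/ (U %% 2)%Z = 0 by lia.
  have cUV : c = U + (c - U) by ring.
  have XUV : X = U - (c - U) by clear -UE; lia.
  rewrite {1}cUV {1}XUV; apply: (quadratic_forms_mod4_odd (d := d) p_pr);
    rewrite -?cUV -?XUV //.
  by clear -U2 c_odd; lia.
(* Replacing [c] by [- c] exchanges the two halves up to sign, and makes the first one odd. *)
have cUV : - c = (U - c) + - U by ring.
have XUV : X = (U - c) - - U by clear -UE; lia.
rewrite -rpredN {1}cUV {1}XUV; apply: (quadratic_forms_mod4_odd (d := d) p_pr);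
  rewrite -?cUV -?XUV ?sqrrN //.
  by clear -U2 c_odd; lia.
by clear -U2; lia.
Qed.

Lemma prime_not_sqr (p : nat) (x : int) : prime p -> x ^+ 2 != p.
Proof.
move=> p_pr; apply/eqP => /(congr1 absz); rewrite abszX /= => xp.
move: p_pr; rewrite -xp; case: `|x|%N => [|[|n]] // /primeP[_] /(_ n.+2).
by rewrite dvdn_exp // => /(_ isT); rewrite -{2}(expn1 n.+2) eqn_exp2l.
Qed.

(** Thue's lemma with a square root of -1. As [p] is not a square, [x ^+ 2 + y ^+ 2] is below
    [2 * p], hence equal to [p]. *)
Lemma prime_sum2sqr (p : nat) : prime p -> p = 1 %[mod 4] ->
  exists c d : int, p%:Z = c ^+ 2 + 4 * d ^+ 2.
Proof.
move=> p_pr p4; have [t tP] := prime_sqrt_opp1 p_pr p4.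
have p_gt0 := prime_gt0 p_pr.
have [x [y [xy xy0 x_le y_le]]] := thue t p_gt0.
have /dvdzP[k kE] : (p %| x ^+ 2 + y ^+ 2)%Z.
  have -> : x ^+ 2 + y ^+ 2 = (x + t * y) * (x - t * y) + y ^+ 2 * (t ^+ 2 + 1) by ring.
  by apply: rpredD; apply: dvdz_mull.
have xp := prime_not_sqr x p_pr; have yp := prime_not_sqr y p_pr.
have k1 : k = 1.
  have := sqr_ge0 x; have := sqr_ge0 y.
  have : (0 < x ^+ 2) || (0 < y ^+ 2) by rewrite !exprn_even_gt0 /=.
  move: (x ^+ 2) (y ^+ 2) x_le y_le kE xp yp => a b.
  by clear -p_gt0; nia.
rewrite k1 mul1r in kE.
have := sqrz_mod4 x; have := sqrz_mod4 y => yE xE.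
have [y0|x0] : (y %% 2)%Z = 0 \/ (x %% 2)%Z = 0 by clear -p4 xE yE kE; lia.
  by exists x, (y %/ 2)%Z; rewrite -kE {1}(_ : y = 2 * (y %/ 2)%Z) ?exprMn //; lia.
by exists y, (x %/ 2)%Z; rewrite -kE {1}(_ : x = 2 * (x %/ 2)%Z) ?exprMn 1?addrC //; lia.
Qed.

(** Thue's lemma with a square root of -3 gives [k * p] with [0 < k < 4]. Modulo 4 excludes [k = 2];
    for [k = 3] a division by 3 exchanges the squares. *)
Lemma prime_sqr_3sqr (p : nat) : prime p -> odd p -> p = 1 %[mod 3] ->
  exists x y : int, p%:Z = x ^+ 2 + 3 * y ^+ 2.
Proof.
move=> p_pr p_odd p3; have [t tP] := prime_sqrt_opp3 p_pr p3.
have p_gt0 := prime_gt0 p_pr.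
have [x [y [xy xy0 x_le y_le]]] := thue t p_gt0.
have /dvdzP[k kE] : (p %| x ^+ 2 + 3 * y ^+ 2)%Z.
  have -> : x ^+ 2 + 3 * y ^+ 2 = (x + t * y) * (x - t * y) + y ^+ 2 * (t ^+ 2 + 3) by ring.
  by apply: rpredD; apply: dvdz_mull.
have xp := prime_not_sqr x p_pr; have yp := prime_not_sqr y p_pr.
have [k_gt0 k_lt4] : 0 < k /\ k < 4.
  have := sqr_ge0 x; have := sqr_ge0 y.
  have : (0 < x ^+ 2) || (0 < y ^+ 2) by rewrite !exprn_even_gt0 /=.
  move: (x ^+ 2) (y ^+ 2) x_le y_le kE xp yp => a b.
  by clear -p_gt0; split; nia.
have xE := sqrz_mod4 x; have yE := sqrz_mod4 y.
have [k1|[k2|k3]] : k = 1 \/ k = 2 \/ k = 3 by lia.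
- by exists x, y; rewrite kE k1 mul1r.
- by clear -k2 kE xE yE p_odd; lia.
have /dvdzP[z zE] : (3 %| x)%Z by rewrite -(prime_dvdzX _ (isT : prime 3)); lia.
exists y, z; move: kE; rewrite k3 zE exprMn; clear; lia.
Qed.

(** Membership in [P1] means that 3 divides the odd term [c] of [p = c ^+ 2 + 4 * d ^+ 2]. On the
    other side, [(X + 2 * w, 4 * w)] has norm [p], is 1 modulo [1 - w], and modulo 4 reduces to the
    integer [X + 2 * w]. *)
Lemma P1E (p : nat) (X w : int) : prime p -> p = 1 %[mod 12] ->
  p%:Z = X ^+ 2 + 12 * w ^+ 2 -> (X %% 3)%Z = 1 -> P1 p <-> ((X + 2 * w) %% 4)%Z = 3.
Proof.
move=> p_pr p12 pX X3; have p_odd : odd p by lia.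
split=> [[_ _ [k [t pkt]]]|Xw].
  apply/eqP; rewrite -(quadratic_forms_mod4 (c := 6 * t + 3) (d := 3 * k + 1) p_pr p_odd _ pX X3).
    by lia.
  by rewrite pkt; ring.
have [c [d pcd]] := @prime_sum2sqr p p_pr ltac:(lia).
have /eqP c3 := Xw; rewrite -(quadratic_forms_mod4 p_pr p_odd pcd pX X3) in c3.
split=> //.
have [t tE] : exists t, c = 6 * t + 3.
  by exists ((c - 3) %/ 6)%Z; have := sqrz_mod4 c; clear -pcd p_odd c3; lia.
have : ~~ (3 %| d)%Z.
  apply/negP => /dvdzP[d' dE]; move: pcd; rewrite tE dE.
  have -> : (6 * t + 3) ^+ 2 + 4 * (d' * 3) ^+ 2 = 3 * (3 * ((2 * t + 1) ^+ 2 + 4 * d' ^+ 2))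
    by ring.
  by clear -p12; lia.
move=> d3; have [d1|d2] : (d %% 3)%Z = 1 \/ (d %% 3)%Z = 2 by clear -d3; lia.
  exists (d %/ 3)%Z, t; rewrite pcd tE {1}(_ : d = 3 * (d %/ 3)%Z + 1); last by lia.
  by ring.
(* Here [6 * k + 2] is [- 2 * d]. *)
exists (- (d %/ 3)%Z - 1), t; rewrite pcd tE {1}(_ : d = 3 * (d %/ 3)%Z + 2); last by lia.
by ring.
Qed.

(** * Prime factors of norms *)

Lemma enorm_ge0 e : 0 <= enorm e.
Proof. by case: e => a b; rewrite /enorm /=; nia. Qed.

Lemma enorm_scale (k a b : int) : enorm (k * a, k * b) = k ^+ 2 * enorm (a, b).
Proof. by rewrite /enorm /=; ring. Qed.

Lemma prime_factor_3mod4 (n : nat) : n = 3 %[mod 4] ->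
  exists q, [/\ prime q, q = 3 %[mod 4] & (q %| n)%N].
Proof.
elim/ltn_ind: n => n IH n3.
have n_gt1 : (1 < n)%N by case: n n3 {IH} => [|[|]].
have [q3|q3] := eqVneq (pdiv n %% 4)%N 3%N.
  by exists (pdiv n); rewrite pdiv_prime ?pdiv_dvd.
have [m nE] := dvdnP (pdiv_dvd n); set q := pdiv n in q3 nE *.
have q_gt1 : (1 < q)%N by rewrite prime_gt1 ?pdiv_prime.
have m3 : m = 3 %[mod 4].
  have := modnMm m q 4; rewrite -nE n3; move: q3.
  have : (q %% 4 < 4)%N by rewrite ltn_mod.
  have : (m %% 4 < 4)%N by rewrite ltn_mod.
  by move: (m %% 4)%N (q %% 4)%N => [|[|[|[|//]]]] [|[|[|[|//]]]].
have m_lt : (m < n)%N by rewrite nE ltn_Pmulr //; lia.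
have [r [r_pr r3 r_m]] := IH m m_lt m3.
by exists r; split; rewrite // nE dvdn_mulr.
Qed.

Lemma inert_factor q (e : eis) : prime q -> q = 2 %[mod 3] -> (q %| enorm e)%Z ->
  exists a b, e = (q%:Z * a, q%:Z * b) /\ enorm e = q%:Z ^+ 2 * enorm (a, b).
Proof.
case: e => x y q_pr q2 /(prime_inert q_pr q2)[/= /dvdzP[a ->] /dvdzP[b ->]].
by exists a, b; rewrite -enorm_scale ![_ * q%:Z]mulrC.
Qed.

Lemma absz_sqr_mul_lt (q : nat) (n : int) : (1 < q)%N -> 0 < n -> n < q%:Z ^+ 2 * n.
Proof. by move=> q1 n0; rewrite -[ltLHS]mul1r ltr_pM2r // exprn_egt1 // ltz_nat. Qed.

(** Some prime factor is 3 modulo 4, and it is not 3. If it is 11 modulo 12 it is inert, so its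
    square, which is 1 modulo 12, can be divided out. *)
Lemma enorm_7mod12 (e : eis) : (enorm e %% 12)%Z = 7 ->
  exists p, prime_mod12 7 p /\ (p %| enorm e)%Z.
Proof.
have [n] := ubnP `|enorm e|%N; elim: n e => // n IH e le_n e7.
have N0 := enorm_ge0 e.
have [q [q_pr q3 q_N]] : exists q, [/\ prime q, q = 3 %[mod 4] & (q %| `|enorm e|)%N].
  by apply: prime_factor_3mod4; lia.
have q_ne3 : (q != 3)%N by apply/eqP => q3'; move: q_N; rewrite q3'; lia.
have q_n3 : ~~ (3 %| q)%N by rewrite dvdn_prime2 // eq_sym.
have [q7|q11] : (q %% 12 = 7)%N \/ (q %% 12 = 11)%N by lia.
  by exists q; rewrite dvdzE.
have [||a [b [eE NE]]] := @inert_factor q e q_pr; [by lia|by rewrite dvdzE|].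
have q_gt1 := prime_gt1 q_pr.
have qq : (q%:Z ^+ 2 %% 12)%Z = 1.
  have := @sqr_prime_mod12 q; rewrite -mulnn => /(_ _ q_n3) h.
  have : (q * q %% 12 = 1 %% 12)%N by apply: h; lia.
  by rewrite -[q%:Z ^+ 2]/(q * q)%N%:Z; lia.
have N0' := enorm_ge0 (a, b).
have [||p [p7 p_N]] := IH (a, b).
- have [N0''|N_gt0] : enorm (a, b) = 0 \/ 0 < enorm (a, b) by clear -N0'; lia.
    by move: e7; rewrite NE N0'' mulr0.
  by have := absz_sqr_mul_lt q_gt1 N_gt0; rewrite -NE; clear -le_n N0'; lia.
- have := modzMm (q%:Z ^+ 2) (enorm (a, b)) 12; rewrite -NE e7 qq; lia.
by exists p; rewrite NE dvdz_mull.
Qed.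

(** [a * u + b * v - a * v] and [b * u - a * v] are the coordinates of [(a, b)] times the conjugate
    of [(u, v)]. The prime [q] divides the second one for [(u, v)] or for its conjugate; then it
    divides the first as well, and the quotient is the cofactor. *)
Lemma prime_norm_dvd (q : nat) (u v a b : int) : prime q -> enorm (u, v) = q ->
  (q %| enorm (a, b))%Z ->
  exists e : eis, (a, b) = ((u, v) : eis) * e \/ (a, b) = ((u - v, - v) : eis) * e.
Proof.
move=> q_pr Nq; rewrite /enorm /= in Nq.
have q_neq0 : q%:Z != 0 by have := prime_gt0 q_pr; lia.
wlog : u v Nq / (q %| b * u - a * v)%Z.
  move=> wl qN.
  have : (q %| (b * u - a * v) * (b * (u - v) - a * (- v)))%Z.
    have -> : (b * u - a * v) * (b * (u - v) - a * (- v)) =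
        b ^+ 2 * (u ^+ 2 - u * v + v ^+ 2) - v ^+ 2 * enorm (a, b) by rewrite /enorm /=; ring.
    by rewrite Nq; apply: rpredB; apply: dvdz_mull.
  rewrite dvdzE abszM Euclid_dvdM // -!(dvdzE q) => /orP[] h.
    exact: wl Nq h qN.
  have [|e [eE|eE]] := wl (u - v) (- v) _ h qN.
  - by rewrite -Nq; ring.
  - by exists e; right.
  - by exists e; left; rewrite eE opprK subrK.
move=> q_s qN.
have q_t : (q %| a * u + b * v - a * v)%Z.
  rewrite -(prime_dvdzX _ q_pr).
  have -> : (a * u + b * v - a * v) ^+ 2 = enorm (a, b) * q +
    (b * u - a * v) * ((a * u + b * v - a * v) - (b * u - a * v)) by rewrite -Nq /enorm /=; ring.
  by apply: rpredD; [apply: dvdz_mull|apply: dvdz_mulr].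
have /dvdzP[s sE] := q_s; have /dvdzP[t tE] := q_t.
exists (t, s); left; congr pair; apply: (mulfI q_neq0) => /=.
  by transitivity (u * (t * q) - v * (s * q)); [rewrite -sE -tE -Nq|]; ring.
by transitivity (u * (s * q) + v * (t * q) - v * (s * q)); [rewrite -sE -tE -Nq|]; ring.
Qed.

(** The factor is [X] plus [2 * w] times [(1, 2)], a square root of -3. The sign of [X] is chosen
    modulo 3, and conjugation only changes the sign of [w]. *)
Lemma eis_prime_factor (q : nat) (a b : int) : prime q -> q = 1 %[mod 12] ->
  (q %| enorm (a, b))%Z -> exists X w x y : int,
  [/\ q%:Z = X ^+ 2 + 12 * w ^+ 2, (X %% 3)%Z = 1 &
      (a, b) = ((X + 2 * w, 4 * w) : eis) * (x, y)].
Proof.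
move=> q_pr q12 qN.
have [||X0 [Y qXY]] := prime_sqr_3sqr q_pr; [lia|lia|].
have [w YE] : exists w, Y = 2 * w.
  exists (Y %/ 2)%Z; have := sqrz_mod4 X0; have := sqrz_mod4 Y; clear -qXY q12; lia.
have [X [qX X3]] : exists X, q%:Z = X ^+ 2 + 12 * w ^+ 2 /\ (X %% 3)%Z = 1.
  have X03 : ~~ (3 %| X0)%Z.
    by rewrite -(prime_dvdzX _ (isT : prime 3)); clear -qXY q12; lia.
  have [X1|X2] : (X0 %% 3)%Z = 1 \/ (X0 %% 3)%Z = 2 by clear -X03; lia.
    by exists X0; split=> //; rewrite qXY YE; ring.
  exists (- X0); split; first by rewrite qXY YE; ring.
  by clear -X2; lia.
have [|[x y] [xyE|xyE]] := @prime_norm_dvd q (X + 2 * w) (4 * w) a b q_pr _ qN.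
- by rewrite qX /enorm /=; ring.
- by exists X, w, x, y.
exists X, (- w), x, y; split=> //; first by rewrite sqrrN.
rewrite xyE (_ : X + 2 * w - 4 * w = X + 2 * - w); last by ring.
by rewrite !mulrN.
Qed.

(* [a + b w] is -1 modulo 4 and 1 modulo [1 - w]; the induction removes prime
   factors whose normalized generator is 1 modulo 4. *)
Lemma admissible_dvd_enorm (a b : int) : (a %% 4)%Z = 3 -> (4 %| b)%Z ->
  ((a + b) %% 3)%Z = 1 -> exists k, admissible_k k /\ (k %| enorm (a, b))%Z.
Proof.
have [n] := ubnP `|enorm (a, b)|%N; elim: n a b => // n IH a b le_n a4 b4 ab3.
have N0 := enorm_ge0 (a, b).
have N12 : (enorm (a, b) %% 12)%Z = 1.
  have [b' bE] := dvdzP b4.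
  have := sqrz_mod4 a; have := sqrz_mod24 (a + b).
  have -> : (a + b) ^+ 2 = enorm (a, b) + 3 * (a * b) by rewrite /enorm /=; ring.
  have : enorm (a, b) = a ^+ 2 + 4 * (b' * (b - a)) by rewrite /enorm bE /=; ring.
  have : ~~ (3 %| enorm (a, b) + 3 * (a * b))%Z.
    rewrite (_ : _ + _ = (a + b) ^+ 2) ?(prime_dvdzX _ (isT : prime 3)); last first.
      by rewrite /enorm /=; ring.
    by clear -ab3; lia.
  move: (enorm (a, b)) (a * b) (b' * (b - a)) (a ^+ 2) => m c d f; rewrite !inE.
  by clear -a4; lia.
set m := `|enorm (a, b)|%N in le_n.
have mE : enorm (a, b) = m by rewrite /m; lia.
have m12 : m = 1 %[mod 12] by clear -mE N12; lia.
have step (q : nat) x y : (1 < q)%N -> (q%:Z * enorm (x, y) = m) -> (`|enorm (x, y)| < n)%N.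
  move=> q1 qN; have := enorm_ge0 (x, y) => Nx0.
  have [Nx00|Nxgt0] : enorm (x, y) = 0 \/ 0 < enorm (x, y) by clear -Nx0; lia.
    by move: qN m12; rewrite Nx00 mulr0 => -[<-].
  have : enorm (x, y) < q%:Z * enorm (x, y) by rewrite -[ltLHS]mul1r ltr_pM2r // ltz_nat.
  by rewrite qN; clear -le_n Nx0; lia.
have m_gt0 : (0 < m)%N by clear -m12; lia.
have m2 q : prime q -> (q %| m)%N -> [\/ q %% 12 = 1, q %% 12 = 5, q %% 12 = 7 | q %% 12 = 11]%N.
  move=> q_pr /dvdnP[r rE].
  have : ~~ (2 %| q)%N.
    by apply/negP => /dvdnP[s sE]; move: m12; rewrite rE sE mulnA; clear; lia.
  have : ~~ (3 %| q)%N.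
    by apply/negP => /dvdnP[s sE]; move: m12; rewrite rE sE mulnA; clear; lia.
  move=> h3 h2; suff : ((q %% 12 = 1) \/ (q %% 12 = 5) \/ (q %% 12 = 7) \/ (q %% 12 = 11))%N.
    by move=> [|[|[|]]]; [constructor 1|constructor 2|constructor 3|constructor 4].
  have : (q %% 2 = 1)%N by clear -h2; lia.
  have : (q %% 3 <> 0)%N by clear -h3; lia.
  have : (q %% 12 < 12)%N by rewrite ltn_mod.
  by clear; lia.
have [/hasP[q]|no5] := boolP (has (fun q => q %% 12 == 5)%N (primes m)).
  rewrite mem_primes => /and3P[q_pr _ q_m] /eqP q5.
  have [||x [y [_ NE]]] := @inert_factor q (a, b) q_pr; [by lia|by rewrite mE dvdzE|].
  exists (q ^ 2)%N; split; first by constructor 2; exists q.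
  by rewrite NE -[(q ^ 2)%N%:Z]/(q%:Z ^+ 2) dvdz_mulr.
have [/hasP[q]|no11] := boolP (has (fun q => q %% 12 == 11)%N (primes m)).
  rewrite mem_primes => /and3P[q_pr _ q_m] /eqP q11.
  have [||x [y [[aE bE] NE]]] := @inert_factor q (a, b) q_pr; [by lia|by rewrite mE dvdzE|].
  have N_opp : enorm (- x, - y) = enorm (x, y) by rewrite /enorm /=; ring.
  have q_gt1 := prime_gt1 q_pr.
  (* [- q] is 1 modulo 12, so division by [- q] preserves the three congruences. *)
  have [||||k [k_adm k_N]] := IH (- x) (- y).
  - rewrite N_opp; apply: (step (q ^ 2)%N); first by rewrite (ltn_exp2l 0).
    by rewrite -mE NE.
  - have := modzMm q%:Z x 4; rewrite -aE a4.
    have -> : (q%:Z %% 4)%Z = 3 by clear -q11; lia.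
    by clear; lia.
  - move: b4; rewrite bE rpredN Gauss_dvdzr // coprimezE /=.
    by rewrite coprime_sym (coprimeXr 2 (_ : coprime q 2)) // coprimen2; clear -q11; lia.
  - have := modzMm q%:Z (x + y) 3; have -> : q%:Z * (x + y) = a + b by rewrite aE bE; ring.
    rewrite ab3.
    have -> : (q%:Z %% 3)%Z = 2 by clear -q11; lia.
    by clear; lia.
  by exists k; split=> //; rewrite NE -N_opp dvdz_mull.
have no11' r : prime r -> (r %| m)%N -> (r %% 12 != 11)%N.
  by move=> r_pr r_m; move/hasPn: no11; apply; rewrite mem_primes r_pr m_gt0.
have [/hasP[q]|no7] := boolP (has (fun q => q %% 12 == 7)%N (primes m)).
  rewrite mem_primes => /and3P[q_pr _ q_m] /eqP q7.
  have [r rE] := dvdnP q_m.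
  (* The cofactor of a prime 7 modulo 12 is again 3 modulo 4 and supplies the second such prime. *)
  have r4 : r = 3 %[mod 4].
    have := modnMm r q 4; rewrite -rE.
    have -> : (q %% 4 = 3)%N by clear -q7; lia.
    have -> : (m %% 4 = 1)%N by clear -m12; lia.
    have : (r %% 4 < 4)%N by rewrite ltn_mod.
    by case: (r %% 4)%N => [|[|[|[|]]]].
  have [q' [q'_pr q'4 q'_r]] := prime_factor_3mod4 r4.
  have q'_m : (q' %| m)%N by rewrite rE dvdn_mulr.
  have q'7 : (q' %% 12 = 7)%N.
    by have := m2 q' q'_pr q'_m; have := no11' q' q'_pr q'_m; clear -q'4 => n11 []; lia.
  exists (q' * q)%N; split; first by constructor 3; exists q', q.
  by rewrite mE dvdzE /= rE dvdn_pmul2r // prime_gt0.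
(* Norm 1 with [b] divisible by 4 leaves only 1 and -1, and neither meets both congruences. *)
have m_gt1 : (1 < m)%N.
  rewrite ltn_neqAle m_gt0 andbT eq_sym; apply/eqP => m1.
  have [b' bE] := dvdzP b4.
  have e1 : (a - 2 * b') ^+ 2 + 12 * b' ^+ 2 = 1
    by transitivity (enorm (a, b)); [rewrite /enorm bE /=; ring|rewrite mE m1].
  have b'0 : b' = 0.
    apply/eqP; rewrite -sqrf_eq0; have := sqr_ge0 (a - 2 * b'); have := sqr_ge0 b'.
    by move: e1; clear; lia.
  have /eqP : a ^+ 2 = 1 by rewrite -e1 b'0; ring.
  by rewrite sqrf_eq1 => /orP[] /eqP aE; move: a4 ab3; rewrite bE b'0 aE.
have q_pr := pdiv_prime m_gt1; have q_m := pdiv_dvd m; set q := pdiv m in q_pr q_m.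
have q12 : (q %% 12 = 1)%N.
  have := m2 q q_pr q_m; have := no11' q q_pr q_m.
  have q_primes : q \in primes m by rewrite mem_primes q_pr m_gt0.
  by have := hasPn no5 q q_primes; have := hasPn no7 q q_primes; clear => ? ? ? []; lia.
have [|X [w [x [y [qX X3 [aE bE]]]]]] := @eis_prime_factor q a b q_pr q12.
  by rewrite mE dvdzE.
have [Xw|Xw] := eqVneq ((X + 2 * w) %% 4)%Z 3.
  exists q; split; last by rewrite mE dvdzE.
  by constructor 1; apply/(P1E q_pr q12 qX X3).
have Xw1 : ((X + 2 * w) %% 4)%Z = 1.
  by have := sqrz_mod4 X; clear -qX q12 Xw; lia.
simpl in aE, bE.
have NE : enorm (a, b) = q%:Z * enorm (x, y) by rewrite qX /enorm /= aE bE; ring.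
have [||||k [k_adm k_N]] := IH x y.
- by apply: (step q); rewrite ?prime_gt1 // -NE.
- have := modzMm (X + 2 * w) x 4.
  have -> : (X + 2 * w) * x = a + 4 * (w * y) by rewrite aE; ring.
  by rewrite Xw1; move: a4; clear; lia.
- have : (4 %| (X + 2 * w) * y)%Z.
    have -> : (X + 2 * w) * y = b + 4 * (w * y - w * x) by rewrite bE; ring.
    by move: b4; clear; lia.
  by rewrite Gauss_dvdzr // /coprimez -gcdz_modr Xw1.
- have := modzMm (X + 6 * w) (x + y) 3.
  have -> : (X + 6 * w) * (x + y) = a + b + 3 * (4 * w * y) by rewrite aE bE; ring.
  have -> : ((X + 6 * w) %% 3)%Z = 1 by move: X3; clear; lia.
  by move: ab3; clear; lia.
by exists k; split=> //; rewrite NE dvdz_mull.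
Qed.

(** * Every determinant is one of the listed values *)

Lemma modzM_eq (d x y r s t : int) : (x %% d)%Z = r -> (y %% d)%Z = s ->
  (r * s %% d)%Z = t -> ((x * y) %% d)%Z = t.
Proof. by move=> <- <-; rewrite modzMm. Qed.

(** Odd entries [1 + 2 a'], ... have an even sum of the [a'], so the product is 1 modulo 4. Even
    entries have halves with even sum: either all four halves are odd, or at least two are even. *)
Lemma klein_prod (a b c d : int) : klein a b c d ->
  [\/ ((a * b * c * d) %% 4)%Z = 1,
      exists2 x, (x %% 2)%Z = 1 & a * b * c * d = 16 * x
    | exists x, a * b * c * d = 64 * x].
Proof.
move=> [ab ac ad abcd].
have halve (x r : int) : (x %% 2)%Z = r -> exists x', x = r + 2 * x'.
  by move=> <-; exists (x %/ 2)%Z; clear; lia.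
have [a1|a0] : (a %% 2)%Z = 1 \/ (a %% 2)%Z = 0 by lia.
  have [a' aE] := halve _ _ a1.
  have [b' bE] := halve b 1 ltac:(lia).
  have [c' cE] := halve c 1 ltac:(lia).
  have [d' dE] := halve d 1 ltac:(lia).
  have [s sE] : exists s, a' + b' + c' + d' = 2 * s.
    by exists ((a' + b' + c' + d') %/ 2)%Z; lia.
  constructor 1.
  have -> : a * b * c * d = 4 * (s + a' * b' + a' * c' + a' * d' + b' * c' + b' * d' + c' * d'
     + 2 * (a' * b' * c' + a' * b' * d' + a' * c' * d' + b' * c' * d')
     + 4 * (a' * b' * c' * d')) + 1.
    transitivity (2 * (a' + b' + c' + d') + 4 * (a' * b' + a' * c' + a' * d' + b' * c' + b' * d' + c' * d'
     + 2 * (a' * b' * c' + a' * b' * d' + a' * c' * d' + b' * c' * d')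
     + 4 * (a' * b' * c' * d')) + 1); last by rewrite sE; ring.
    by rewrite aE bE cE dE; ring.
  by clear; lia.
have [a' aE] := halve _ _ a0; rewrite add0r in aE.
have [b' bE] := halve b 0 ltac:(lia); rewrite add0r in bE.
have [c' cE] := halve c 0 ltac:(lia); rewrite add0r in cE.
have [d' dE] := halve d 0 ltac:(lia); rewrite add0r in dE.
have E : a * b * c * d = 16 * (a' * b' * c' * d') by rewrite aE bE cE dE; ring.
have two (x y z t : int) : a * b * c * d = 16 * (x * y * z * t) ->
    (x %% 2)%Z = 0 -> (y %% 2)%Z = 0 -> exists x, a * b * c * d = 64 * x.
  move=> -> /halve[x' ->] /halve[y' ->]; exists (x' * y' * z * t); ring.
have s2 : ((a' + b' + c' + d') %% 2)%Z = 0 by move: abcd; rewrite aE bE cE dE; clear; lia.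
have parity (x : int) : (x %% 2)%Z = 1 \/ (x %% 2)%Z = 0 by clear; lia.
have [a1|a1] := parity a'; last first.
  constructor 3; have [b1|b1] := parity b'; last by apply: (two a' b' c' d').
  have [c1|c1] := parity c'; last by apply: (two a' c' b' d') => //; rewrite E; ring.
  by apply: (two a' d' b' c') => //; [rewrite E; ring|move: s2; clear -a1 b1 c1; lia].
have [b1|b1] := parity b'; last first.
  constructor 3; have [c1|c1] := parity c'; last by apply: (two b' c' a' d') => //; rewrite E; ring.
  by apply: (two b' d' a' c') => //; [rewrite E; ring|move: s2; clear -a1 b1 c1; lia].
have [c1|c1] := parity c'; last first.
  constructor 3; apply: (two c' d' a' b') => //; first by rewrite E; ring.
  by move: s2; clear -a1 b1 c1; lia.
have d1 : (d' %% 2)%Z = 1 by move: s2; clear -a1 b1 c1; lia.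
constructor 2; exists (a' * b' * c' * d') => //.
exact: modzM_eq (modzM_eq (modzM_eq a1 b1 erefl) c1 erefl) d1 erefl.
Qed.

(* Modulo 3, the residue of [e] modulo [1 - w]. *)
Definition eaug (e : eis) : int := e.1 + e.2.
Lemma eaug_mul (x y : eis) : (eaug (x * y) %% 3)%Z = ((eaug x * eaug y) %% 3)%Z.
Proof.
have -> : eaug (x * y) = - (x.2 * y.2) * 3 + eaug x * eaug y.
  by case: x y => [a b] [c d]; rewrite /eaug /=; ring.
by rewrite modzMDl.
Qed.

Lemma enorm_mod3 e : (enorm e %% 3)%Z = (eaug e ^+ 2 %% 3)%Z.
Proof.
have -> : enorm e = - (e.1 * e.2) * 3 + eaug e ^+ 2 by rewrite /enorm /eaug; ring.
by rewrite modzMDl.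
Qed.

(** The expansion used for odd entries in [klein_prod], carried out in [eis]. *)
Lemma eis_prod_1mod2 (e f g h : eis) :
  klein e.1 f.1 g.1 h.1 -> klein e.2 f.2 g.2 h.2 ->
  (e.1 %% 2)%Z = 1 -> (e.2 %% 2)%Z = 0 ->
  ((e * f * g * h).1 %% 4)%Z = 1 /\ (4 %| (e * f * g * h).2)%Z.
Proof.
move=> [ef1 eg1 eh1 s1] [ef2 eg2 eh2 s2] e1 e2.
have halve (x : eis) : (x.1 %% 2)%Z = 1 -> (x.2 %% 2)%Z = 0 -> exists x' : eis, x = 1 + (x' + x').
  case: x => x y /= x1 y0; exists ((x %/ 2)%Z, (y %/ 2)%Z).
  by congr pair => /=; lia.
have [x eE] := halve e e1 e2.
have [y fE] := halve f ltac:(lia) ltac:(lia).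
have [z gE] := halve g ltac:(lia) ltac:(lia).
have [t hE] := halve h ltac:(lia) ltac:(lia).
have [s sE] : exists s : eis, x + y + z + t = s + s.
  move: s1 s2; rewrite eE fE gE hE /= => s1 s2.
  exists (((x + y + z + t).1 %/ 2)%Z, ((x + y + z + t).2 %/ 2)%Z).
  by rewrite [LHS]surjective_pairing; congr pair; rewrite /=; lia.
have -> : e * f * g * h = 1 + (4 : eis) * (s + x * y + x * z + x * t + y * z + y * t + z * t
     + 2 * (x * y * z + x * y * t + x * z * t + y * z * t)
     + 4 * (x * y * z * t)).
  transitivity (1 + 2 * (x + y + z + t) + (4 : eis) * (x * y + x * z + x * t + y * z + y * t + z * t
     + 2 * (x * y * z + x * y * t + x * z * t + y * z * t)
     + 4 * (x * y * z * t))); last by rewrite sE; ring.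
  by rewrite eE fE gE hE; ring.
move: (s + _ + _ + _ + _ + _ + _ + _ + _) => r.
rewrite (_ : 4 = 4%:~R :> eis) // intr_mulE /=.
by lia.
Qed.

Lemma even_norm (e : eis) : (enorm e %% 2)%Z = 0 -> 
  exists e' : eis, e = e' + e' /\ enorm e = 4 * enorm e'.
Proof.
move=> e2; have [|||a [b [eE _]]] := @inert_factor 2 e; [by []|by []|by lia|].
exists (a, b); split; first by rewrite eE; congr pair => /=; lia.
by rewrite eE /enorm /=; ring.
Qed.

(** Modulo 2, [eis] is the field with four elements, whose units are 1, [w] and [w ^ 2]. A common
    power of [w] therefore makes all four factors 1 modulo 2, without effect on norms or on residues
    modulo [1 - w]. *)
Lemma klein_norm_odd (e f g h : eis) :
  klein e.1 f.1 g.1 h.1 -> klein e.2 f.2 g.2 h.2 ->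
  (e.1 %% 2)%Z = 1 \/ (e.2 %% 2)%Z = 1 ->
  exists r : eis, [/\ (r.1 %% 4)%Z = 1, (4 %| r.2)%Z,
    enorm e * enorm f * enorm g * enorm h = enorm r
    & (eaug r %% 3)%Z = ((eaug e * eaug f * eaug g * eaug h) %% 3)%Z].
Proof.
move=> k1 k2 e12.
have finish (w : eis) : enorm w = 1 -> (eaug w ^+ 4 = 1 %[mod 3])%Z ->
    klein (e * w).1 (f * w).1 (g * w).1 (h * w).1 ->
    klein (e * w).2 (f * w).2 (g * w).2 (h * w).2 ->
    ((e * w).1 %% 2)%Z = 1 -> ((e * w).2 %% 2)%Z = 0 ->
    exists r : eis, [/\ (r.1 %% 4)%Z = 1, (4 %| r.2)%Z,
    enorm e * enorm f * enorm g * enorm h = enorm r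
    & (eaug r %% 3)%Z = ((eaug e * eaug f * eaug g * eaug h) %% 3)%Z].
  move=> Nw tw kw1 kw2 w1 w0; have [r1 r2] := eis_prod_1mod2 kw1 kw2 w1 w0.
  exists ((e * w) * (f * w) * (g * w) * (h * w)); split=> //.
    by rewrite !enorm_mul Nw !mulr1.
  have M (x y : eis) (u v : int) : (eaug x = u %[mod 3])%Z -> (eaug y = v %[mod 3])%Z ->
      (eaug (x * y) = u * v %[mod 3])%Z by rewrite eaug_mul -modzMm => -> ->; rewrite modzMm.
  have twP (P : int) : (P = P * eaug w ^+ 4 %[mod 3])%Z by rewrite -modzMmr tw modzMmr mulr1.
  rewrite [RHS]twP.
  have -> : eaug e * eaug f * eaug g * eaug h * eaug w ^+ 4 =
     eaug e * eaug w * (eaug f * eaug w) * (eaug g * eaug w) *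
     (eaug h * eaug w) by ring.
  exact: (M _ _ _ _ (M _ _ _ _ (M _ _ _ _ (eaug_mul e w) (eaug_mul f w))
    (eaug_mul g w)) (eaug_mul h w)).
have [e2|e2] : (e.2 %% 2)%Z = 0 \/ (e.2 %% 2)%Z = 1 by clear; lia.
  apply: (finish 1); rewrite ?mulr1 //.
  by case: e12; lia.
have [ef1 eg1 eh1 s1] := k1; have [ef2 eg2 eh2 s2] := k2.
have [e1|e1] : (e.1 %% 2)%Z = 0 \/ (e.1 %% 2)%Z = 1 by clear; lia.
  by apply: (finish (-1, -1)) => //=; try split; lia.
by apply: (finish (0, 1)) => //=; try split; lia.
Qed.

(** 2 is inert of norm 4: the four factors contribute [2 ^+ 8], and further powers of 2 come in
    pairs. *)
Lemma klein_norm_even (e f g h : eis) :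
  klein e.1 f.1 g.1 h.1 -> klein e.2 f.2 g.2 h.2 ->
  (e.1 %% 2)%Z = 0 -> (e.2 %% 2)%Z = 0 ->
  exists t : eis,
  [\/ (enorm t %% 2)%Z = 1 /\ enorm e * enorm f * enorm g * enorm h = 2 ^+ 8 * enorm t,
   (enorm t %% 2)%Z = 1 /\ enorm e * enorm f * enorm g * enorm h = 2 ^+ 10 * enorm t |
   enorm e * enorm f * enorm g * enorm h = 2 ^+ 12 * enorm t].
Proof.
move=> [ef1 eg1 eh1 s1] [ef2 eg2 eh2 s2] e1 e2.
have halve (x : eis) : (x.1 %% 2)%Z = 0 -> (x.2 %% 2)%Z = 0 -> exists x', enorm x = 4 * enorm x'.
  case: x => x y /= x1 y0; exists ((x %/ 2)%Z, (y %/ 2)%Z).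
  have {1}-> : x = 2 * (x %/ 2)%Z by lia.
  have {1}-> : y = 2 * (y %/ 2)%Z by lia.
  by rewrite enorm_scale.
have [x ->] := halve e e1 e2.
have [y ->] := halve f ltac:(lia) ltac:(lia).
have [z ->] := halve g ltac:(lia) ltac:(lia).
have [t ->] := halve h ltac:(lia) ltac:(lia).
set s := x * y * z * t.
have -> : 4 * enorm x * (4 * enorm y) * (4 * enorm z) * (4 * enorm t) = 2 ^+ 8 * enorm s.
  by rewrite /s !enorm_mul; ring.
have [odd_s|/even_norm[s' [_ ->]]] : (enorm s %% 2)%Z = 1 \/ (enorm s %% 2)%Z = 0 by clear; lia.
  by exists s; constructor 1.
have [odd_s|/even_norm[s'' [_ ->]]] : (enorm s' %% 2)%Z = 1 \/ (enorm s' %% 2)%Z = 0 by clear; lia.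
  by exists s'; constructor 2; split=> //; ring.
by exists s''; constructor 3; ring.
Qed.

Lemma norm_div3 (e : eis) : (3 %| enorm e)%Z -> exists e', enorm e = 3 * enorm e'.
Proof.
rewrite -[(3 %| _)%Z]/((3%N%:Z) %| _)%Z => h.
have : (eaug e ^+ 2 %% 3)%Z = 0 by rewrite -enorm_mod3; lia.
move=> te; have : (3 %| eaug e)%Z by rewrite -(prime_dvdzX _ (isT : prime 3)); lia.
case/dvdzP=> k; rewrite /eaug => kE.
(* The quotient of [e] by [1 + 2 w], a square root of -3. *)
exists (2 * k - e.1, k - e.1); have -> : enorm e = enorm (e.1, 3 * k - e.1).
  by rewrite /enorm /=; congr (_ + _); [congr (_ - _ * _)|congr (_ ^+ _)]; lia.
by rewrite /enorm /=; ring.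
Qed.

(** * The families of values and their powers of 2 *)

Definition value_27 (n : int) := exists m : int,
  [\/ n = 3 ^+ 3 * (4 * m - 1), n = 2 ^+ 4 * 3 ^+ 3 * (2 * m - 1)
    | n = 2 ^+ 6 * 3 ^+ 3 * m].
Definition value_9p (n : int) := exists (m : int) (p : nat), prime_mod12 7 p /\
  [\/ n = 3 ^+ 2 * (4 * m - 1) * p%:Z, n = 2 ^+ 4 * 3 ^+ 2 * (2 * m - 1) * p%:Z
    | n = 2 ^+ 6 * 3 ^+ 2 * m * p%:Z].
Definition value_9 (n : int) := exists m : int,
  [\/ n = 2 ^+ 8 * 3 ^+ 2 * (4 * m - 1), n = 2 ^+ 10 * 3 ^+ 2 * (4 * m - 1),
      n = 2 ^+ 12 * 3 ^+ 2 * (2 * m - 1) | n = 2 ^+ 14 * 3 ^+ 2 * m].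
Definition value_1 (n : int) := exists m : int,
  [\/ n = 12 * m + 1, n = 2 ^+ 4 * (6 * m + 1) | n = 2 ^+ 6 * (3 * m + 1)].
Definition value_k (n : int) := exists (m : int) (k : nat), admissible_k k /\
  [\/ n = (12 * m + 5) * k%:Z, n = - 2 ^+ 4 * (6 * m + 1) * k%:Z
    | n = - 2 ^+ 6 * (3 * m + 1) * k%:Z].
Definition value_2 (n : int) := exists m : int,
  n = 2 ^+ 8 * (12 * m + 5) \/ n = 2 ^+ 10 * (12 * m + 5).
Definition value_2p (n : int) := exists (m : int) (p : nat), prime_mod12 7 p /\
  (n = 2 ^+ 8 * (12 * m + 5) * p%:Z \/ n = 2 ^+ 10 * (12 * m + 5) * p%:Z).
Definition value_12 (n : int) := exists m : int,
  n = - 2 ^+ 12 * (6 * m + 1) \/ n = - 2 ^+ 14 * (3 * m + 1).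

(** Nested like the union in the theorem, so that membership there unfolds to it. *)
Definition values (n : int) : Prop :=
  (((((((value_27 n \/ value_9p n) \/ value_9 n) \/ value_1 n) \/ value_k n) \/
   value_2 n) \/ value_2p n) \/ value_12 n).

(** [klein_prod] provides [r = 1]; division by 3 or 27 turns it into [r = 3], the source of the
    terms [4 * m - 1]. *)
Definition dyadic (r n : int) : Prop :=
  [\/ (n %% 4)%Z = r, exists2 x, (x %% 2)%Z = 1 & n = 16 * x | exists x, n = 64 * x].

Lemma dyadic_mul r n k : dyadic r n -> (k %% 4)%Z = 1 -> dyadic r (n * k).
Proof.
move=> [nr|[x x1 ->]|[x ->]] k1.
- by constructor 1; rewrite -modzMm k1 mulr1 modz_mod.
- constructor 2; exists (x * k); last by rewrite mulrA.
  by apply: (modzM_eq x1 (s := 1)) => //; clear -k1; lia.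
- by constructor 3; exists (x * k); rewrite mulrA.
Qed.

Lemma dyadic_div3 n : dyadic 1 (3 * n) -> dyadic 3 n.
Proof.
move=> [nr|[x x1 nx]|[x nx]].
- by constructor 1; lia.
- by constructor 2; exists (n %/ 16)%Z; lia.
- by constructor 3; exists (n %/ 64)%Z; lia.
Qed.

Lemma dyadic_div27 n : dyadic 1 (27 * n) -> dyadic 3 n.
Proof.
move=> [nr|[x x1 nx]|[x nx]].
- by constructor 1; lia.
- by constructor 2; exists (n %/ 16)%Z; lia.
- by constructor 3; exists (n %/ 64)%Z; lia.
Qed.

Lemma dyadic_value_27 n : dyadic 3 n -> value_27 (27 * n).
Proof.
move=> [nr|[x x1 ->]|[x ->]].
- by exists ((n + 1) %/ 4)%Z; constructor 1; lia.
- by exists ((x + 1) %/ 2)%Z; constructor 2; lia.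
- by exists x; constructor 3; ring.
Qed.

Lemma dyadic_value_9p n p : prime_mod12 7 p -> dyadic 3 n -> value_9p (9 * n * p%:Z).
Proof.
move=> p7 [nr|[x x1 ->]|[x ->]].
- exists ((n + 1) %/ 4)%Z, p; split=> //; constructor 1; congr (_ * _); lia.
- exists ((x + 1) %/ 2)%Z, p; split=> //; constructor 2; congr (_ * _); lia.
- by exists x, p; split=> //; constructor 3; congr (_ * _); ring.
Qed.

Lemma dyadic_value_1 n : (n %% 3)%Z = 1 -> dyadic 1 n -> value_1 n.
Proof.
move=> n3 [nr|[x x1 nE]|[x nE]].
- by exists (n %/ 12)%Z; constructor 1; lia.
- by exists (x %/ 6)%Z; constructor 2; lia.
- by exists (x %/ 3)%Z; constructor 3; lia.
Qed.

Lemma dyadic_value_k n k : admissible_k k -> (n %% 3)%Z = 2 -> dyadic 1 n -> value_k (n * k%:Z).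
Proof.
move=> k_adm n3 [nr|[x x1 nE]|[x nE]].
- by exists (n %/ 12)%Z, k; split=> //; constructor 1; congr (_ * _); lia.
- by exists (- x %/ 6)%Z, k; split=> //; constructor 2; congr (_ * _); lia.
- by exists (- x %/ 3)%Z, k; split=> //; constructor 3; congr (_ * _); lia.
Qed.

Lemma dyadic_value_12 n : (n %% 3)%Z = 2 -> (n %% 2)%Z = 1 \/ (exists x, n = 4 * x) ->
  value_12 (2 ^+ 12 * n).
Proof.
move=> n3 [n1|[x nE]].
- by exists (- n %/ 6)%Z; left; lia.
- by exists (- x %/ 3)%Z; right; lia.
Qed.

Lemma dyadic_value_9 n : (n %% 2)%Z = 1 \/ (exists x, n = 4 * x) -> value_9 (2 ^+ 12 * 9 * n).
Proof.
move=> [n1|[x ->]].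
- by exists ((n + 1) %/ 2)%Z; constructor 3; lia.
- by exists x; constructor 4; ring.
Qed.

Lemma admissible_mod12 k : admissible_k k -> (k%:Z %% 12)%Z = 1.
Proof.
have M (p q : nat) r : (p%:Z %% 12)%Z = r -> (q%:Z %% 12)%Z = r -> ((r * r) %% 12)%Z = 1 ->
    ((p * q)%N%:Z %% 12)%Z = 1 by move=> p1 q1 rr; rewrite PoszM; apply: modzM_eq p1 q1 rr.
case=> [[_ k1 _]|[p [_ p5] ->]|[p [q [[_ p7] [_ q7] ->]]]].
- by lia.
- by rewrite -mulnn; apply: (M p p 5) => //; lia.
- by apply: (M p q 7) => //; lia.
Qed.

Lemma norm_mod3 e : (enorm e %% 3)%Z = 0 \/ (enorm e %% 3)%Z = 1.
Proof.
by rewrite enorm_mod3; have := sqrz_mod24 (eaug e); rewrite !inE; clear; lia.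
Qed.

Lemma norm_7mod12_factor e : (enorm e %% 12)%Z = 7 ->
  exists p m, [/\ prime_mod12 7 p, enorm e = m * p%:Z & (m %% 12)%Z = 1].
Proof.
move=> e7; have [p [[p_pr p7] /dvdzP[m mE]]] := enorm_7mod12 e7.
exists p, m; split=> //.
have := modzMm m p 12; rewrite -mE e7 (_ : (p%:Z %% 12)%Z = 7); last by lia.
by clear; lia.
Qed.

Lemma dvdz3_mod P : (P %% 3)%Z = 0 -> exists P', P = 3 * P'.
Proof. by move=> P0; exists (P %/ 3)%Z; lia. Qed.

(** If 3 divides [P] it also divides [enorm r], and unless 27 divides the value, [enorm r] over 3 is
    7 modulo 12. If [P] is 1 modulo 3, so is the value. If [P] is 2 modulo 3, then [- r] satisfies
    the hypotheses of [admissible_dvd_enorm]. *)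
Lemma necessity_odd P r : dyadic 1 P -> (r.1 %% 4)%Z = 1 -> (4 %| r.2)%Z ->
  (eaug r %% 3)%Z = (P %% 3)%Z -> values (P * enorm r).
Proof.
move=> sP r1 r2 trP.
have N4 : (enorm r %% 4)%Z = 1.
  have [b' bE] := dvdzP r2.
  have -> : enorm r = r.1 ^+ 2 + 4 * (b' * (r.2 - r.1)) by rewrite /enorm bE; ring.
  by have := sqrz_mod4 r.1; move: r1; clear; lia.
have N3 : (enorm r %% 3)%Z = ((P %% 3)%Z ^+ 2 %% 3)%Z by rewrite enorm_mod3 -modzXm trP.
have sD := dyadic_mul sP N4.
have [P3|[P3|P3]] : (P %% 3)%Z = 0 \/ (P %% 3)%Z = 1 \/ (P %% 3)%Z = 2 by clear; lia.
- have [P' PE] := dvdz3_mod P3; subst P.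
  have [e eE] : exists e, enorm r = 3 * enorm e 
    by apply: norm_div3; move: N3; rewrite P3; clear; lia.
  rewrite eE in N4 sD *.
  have [[Q QE]|P'3] : (exists Q, P' * enorm e = 3 * Q) \/ (P' * enorm e %% 3)%Z != 0.
      have [h|h] := eqVneq (P' * enorm e %% 3)%Z 0; last by right.
      by left; exact: dvdz3_mod h.
    have DE : 3 * P' * (3 * enorm e) = 27 * Q 
      by transitivity (9 * (P' * enorm e)); [|rewrite QE]; ring.
    by rewrite DE in sD *; do 7!left; apply: dyadic_value_27; apply: dyadic_div27.
  have e3 : (enorm e %% 3)%Z = 1.
    case: (norm_mod3 e) => // h; move: P'3; rewrite -modzMmr h mulr0; by [].
  have e7 : (enorm e %% 12)%Z = 7 by clear -e3 N4; lia.
  have [p [m [p7 NE m1]]] := norm_7mod12_factor e7.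
  rewrite NE (_ : 3 * P' * (3 * (m * p%:Z)) = 9 * (P' * m) * p%:Z); last by ring.
  do 6!left; right; apply: dyadic_value_9p => //.
  by apply: dyadic_mul; [apply: dyadic_div3|clear -m1; lia].
- do 4!left; right; apply: dyadic_value_1 => //.
  by apply: (modzM_eq P3 (s := 1)) => //; rewrite N3 P3.
have [k [k_adm k_N]] : exists k, admissible_k k /\ (k %| enorm (- r.1, - r.2))%Z.
  apply: admissible_dvd_enorm; first by clear -r1; lia.
    by rewrite rpredN.
  by move: trP; rewrite P3 /eaug; clear; lia.
have {k_N} : (k %| enorm r)%Z by move: k_N; congr (_ %| _)%Z; rewrite /enorm /=; ring.
case/dvdzP=> m mE; have k1 := admissible_mod12 k_adm.
have m12 : (m %% 12)%Z = 1.
  have := modzMm m k 12; rewrite -mE k1.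
  have : (enorm r %% 12)%Z = 1 by move: N3; rewrite P3; clear -N4; lia.
  by clear; lia.
rewrite mE mulrA; do 3!left; right; apply: dyadic_value_k => //.
  by apply: (modzM_eq P3 (s := 1)) => //; clear -m12; lia.
by apply: dyadic_mul => //; clear -m12; lia.
Qed.

Lemma values_1mod3 D x : D = 64 * x -> (D %% 3)%Z = 1 -> values D.
Proof.
by move=> DE D3; do 4!left; right; apply: dyadic_value_1 => //; constructor 3; exists x.
Qed.

Lemma values_27 D x : D = 64 * x -> (27 %| D)%Z -> values D.
Proof.
move=> DE /dvdzP[y yE]; rewrite yE mulrC; do 7!left; apply: dyadic_value_27.
by constructor 3; exists (y %/ 64)%Z; lia.
Qed.

Lemma even_norm_mul4 x e : (x * enorm e %% 2)%Z = 1 \/ 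
  (exists y, x * enorm e = 4 * y) \/ (x %% 2)%Z = 0.
Proof.
have [x0|x1] : (x %% 2)%Z = 0 \/ (x %% 2)%Z = 1 by clear; lia.
  by right; right.
have [e0|e1] : (enorm e %% 2)%Z = 0 \/ (enorm e %% 2)%Z = 1 by clear; lia.
  by have [e' [_ ->]] := even_norm e0; right; left; exists (x * enorm e'); ring.
by left; apply: modzM_eq x1 e1 _.
Qed.

(** From [2 ^+ 12] on, no condition on prime factors remains: the residue modulo 3 selects the
    family. *)
Lemma values_2_12 y : (y %% 2)%Z = 1 \/ (exists x, y = 4 * x) ->
  ((3 %| y)%Z -> (9 %| y)%Z) -> values (2 ^+ 12 * y).
Proof.
move=> y2 y39.
have [y0|[y1|y2']] : (y %% 3)%Z = 0 \/ (y %% 3)%Z = 1 \/ (y %% 3)%Z = 2 by clear; lia.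
- have /dvdzP[z zE] : (9 %| y)%Z by apply: y39; clear -y0; lia.
  rewrite zE [z * 9]mulrC mulrA; do 5!left; right; apply: dyadic_value_9.
  case: y2 => [y1|[x xE]]; first by left; clear -y1 zE; lia.
  by right; exists (z %/ 4)%Z; clear -xE zE; lia.
- by apply: (values_1mod3 (x := 64 * y)); [ring|clear -y1; lia].
- by right; apply: dyadic_value_12.
Qed.

Lemma necessity_2odd P e j : (P %% 4)%Z = 1 -> (enorm e %% 2)%Z = 1 ->
  (enorm e %% 3)%Z = ((P ^+ 2) %% 3)%Z -> j = 8%N \/ j = 10%N -> values (P * (2 ^+ j * enorm e)).
Proof.
move=> P4 e2 e3 j810.
have [x xE] : exists x, 2 ^+ j = 64 * x :> int.
  by case: j810 => ->; [exists 4|exists 16].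
have [x2 x2E] : exists x, (2 ^+ j : int) = 1 + 3 * x.
  by case: j810 => ->; [exists 85|exists 341].
have DE : P * (2 ^+ j * enorm e) = 64 * (P * x * enorm e) by rewrite xE; ring.
have D3 : ((P * (2 ^+ j * enorm e)) %% 3)%Z = ((P * enorm e) %% 3)%Z.
  rewrite x2E (_ : P * _ = (P * x2 * enorm e) * 3 + P * enorm e); last by ring.
  by rewrite modzMDl.
have [P3|[P3|P3]] : (P %% 3)%Z = 0 \/ (P %% 3)%Z = 1 \/ (P %% 3)%Z = 2 by clear; lia.
- have [P' PE] := dvdz3_mod P3; subst P.
  have [f fE] : exists f, enorm e = 3 * enorm f.
    by apply: norm_div3; move: e3; rewrite -modzXm P3; clear; lia.
  rewrite fE in e2 DE *.
  have [f0|f1] := norm_mod3 f.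
    have [g gE] := dvdz3_mod f0.
    apply: values_27 DE _; rewrite gE.
    by rewrite (_ : _ * _ = P' * 2 ^+ j * g * 27) ?dvdz_mull //; ring.
  have [f4|f4] : (enorm f %% 4)%Z = 1 \/ (enorm f %% 4)%Z = 3 by clear -e2; lia.
    have Pf : ((P' * enorm f) %% 4)%Z = 3.
      by apply: (modzM_eq (r := 3) _ f4) => //; clear -P4; lia.
    do 5!left; right; exists ((P' * enorm f + 1) %/ 4)%Z.
    have -> : 4 * ((P' * enorm f + 1) %/ 4)%Z - 1 = P' * enorm f by clear -Pf; lia.
    by case: j810 => ->; [constructor 1|constructor 2]; ring.
  have f12 : (enorm f %% 12)%Z = 7 by clear -f1 f4; lia.
  have [p [m [p7 mE _]]] := norm_7mod12_factor f12.
  do 6!left; right; rewrite mE xE.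
  rewrite (_ : _ * _ = 9 * (64 * (P' * x * m)) * p%:Z); last by ring.
  by apply: dyadic_value_9p => //; constructor 3; eexists.
- apply: (values_1mod3 DE); rewrite D3.
  by apply: (modzM_eq P3 (s := 1)) => //; rewrite e3 -modzXm P3.
have e1 : (enorm e %% 3)%Z = 1 by rewrite e3 -modzXm P3.
have P12 : (P %% 12)%Z = 5 by clear -P3 P4; lia.
have [e12|e12] : (enorm e %% 12)%Z = 1 \/ (enorm e %% 12)%Z = 7 by clear -e1 e2; lia.
  have Pe : ((P * enorm e) %% 12)%Z = 5 by apply: modzM_eq P12 e12 _.
  do 2!left; right; exists ((P * enorm e) %/ 12)%Z.
  have -> : 12 * ((P * enorm e) %/ 12)%Z + 5 = P * enorm e by clear -Pe; lia.
  by case: j810 => ->; [left|right]; ring.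
have [p [m [p7 mE m1]]] := norm_7mod12_factor e12.
have Pm : ((P * m) %% 12)%Z = 5 by apply: modzM_eq P12 m1 _.
left; right; exists ((P * m) %/ 12)%Z, p; split=> //.
have -> : 12 * ((P * m) %/ 12)%Z + 5 = P * m by clear -Pm; lia.
by rewrite mE; case: j810 => ->; [left|right]; ring.
Qed.

(** An even [P] contributes at least [2 ^+ 4], so the value is divisible by [2 ^+ 12] unless [P] is
    odd and [M] is in one of its first two cases. In [lvl12], a value divisible by 3 has 3 dividing
    both [P] and [M], hence 9 dividing the value. *)
Lemma necessity_even P M e : dyadic 1 P -> (M %% 3)%Z = (P ^+ 2 %% 3)%Z ->
  [\/ (enorm e %% 2)%Z = 1 /\ M = 2 ^+ 8 * enorm e,
      (enorm e %% 2)%Z = 1 /\ M = 2 ^+ 10 * enorm e |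
      M = 2 ^+ 12 * enorm e] -> values (P * M).
Proof.
move=> sP M3 ME.
have N3 : (enorm e %% 3)%Z = (P ^+ 2 %% 3)%Z.
  by rewrite -M3; case: ME => [[_ ->]|[_ ->]|->]; clear; lia.
have lvl12 y : P * M = 2 ^+ 12 * y -> (y %% 2)%Z = 1 \/ (exists x, y = 4 * x) -> values (P * M).
  move=> yE y24; rewrite yE; apply: values_2_12 => // y3.
  have P3 : (3 %| P)%Z.
    apply/negPn/negP => P3.
    have [P1|P2] : (P %% 3)%Z = 1 \/ (P %% 3)%Z = 2 by clear -P3; lia.
      have M1 : (M %% 3)%Z = 1 by rewrite M3 -modzXm P1.
      have : ((P * M) %% 3)%Z = 1 by apply: modzM_eq P1 M1 _.
      by rewrite yE; clear -y3; lia.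
    have M1 : (M %% 3)%Z = 1 by rewrite M3 -modzXm P2.
    have : ((P * M) %% 3)%Z = 2 by apply: modzM_eq P2 M1 _.
    by rewrite yE; clear -y3; lia.
  have /dvdzP[P' PE] := P3.
  have /dvdzP[M' ME'] : (3 %| M)%Z.
    by have : (M %% 3)%Z = 0; [rewrite M3 -modzXm PE modzMl|clear; lia].
  have : P * M = 9 * (P' * M') by rewrite PE ME'; ring.
  by rewrite yE; clear; lia.
case: sP => [P4|[x x1 xE]|[x xE]].
- case: ME => [[e2 ->]|[e2 ->]|ME].
  + by apply: necessity_2odd; auto.
  + by apply: necessity_2odd; auto.
  apply: (lvl12 (P * enorm e)); first by rewrite ME; ring.
  have [?|[?|P0]] := even_norm_mul4 P e; [by left|by right|].
  by clear -P4 P0; lia.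
- case: ME => [[e2 ME]|[e2 ME]|ME].
  + apply: (lvl12 (x * enorm e)); first by rewrite ME xE; ring.
    by left; apply: modzM_eq x1 e2 _.
  + by apply: (lvl12 (4 * (x * enorm e))); [rewrite ME xE; ring|right; eexists].
  + apply: (lvl12 (4 * (4 * x * enorm e))); [rewrite ME xE; ring|right; by eexists].
- case: ME => [[e2 ME]|[e2 ME]|ME].
  + by apply: (lvl12 (4 * (x * enorm e))); [rewrite ME xE; ring|right; eexists].
  + by apply: (lvl12 (4 * (4 * x * enorm e))); [rewrite ME xE; ring|right; eexists].
  + by apply: (lvl12 (4 * (16 * x * enorm e))); [rewrite ME xE; ring|right; eexists].
Qed.

Lemma rep_values n : Z6xZ2_rep n -> values n.
Proof.
move=> [a [b [c [d [e [f [g [h [ka k1 k2 [ae bf cg dh] ->]]]]]]]]].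
set P := a * b * c * d; set M := enorm e * enorm f * enorm g * enorm h.
have sP : dyadic 1 P by exact: klein_prod.
have trE (x : int) (y : eis) : (3 %| x - y.1 - y.2)%Z -> (eaug y = x %[mod 3])%Z.
  by rewrite /eaug => h3; clear -h3; lia.
have mM (x y z t : int) : (x = y %[mod 3])%Z -> (z = t %[mod 3])%Z -> (x * z = y * t %[mod 3])%Z.
  by move=> xy zt; rewrite -modzMm xy zt modzMm.
have trP : (eaug e * eaug f * eaug g * eaug h = P %[mod 3])%Z.
  exact: (mM _ _ _ _ (mM _ _ _ _ (mM _ _ _ _ (trE _ _ ae) (trE _ _ bf))
    (trE _ _ cg)) (trE _ _ dh)).
have [odd_e|even_e] : ((e.1 %% 2)%Z = 1 \/ (e.2 %% 2)%Z = 1) \/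
    ((e.1 %% 2)%Z = 0 /\ (e.2 %% 2)%Z = 0) by clear; lia.
  have [r [r1 r2 rE trr]] := klein_norm_odd k1 k2 odd_e; rewrite /M rE.
  by apply: necessity_odd => //; rewrite trr.
have [t tE] := klein_norm_even k1 k2 even_e.1 even_e.2.
apply: necessity_even tE => //.
rewrite -modzXm -trP modzXm !exprMn.
exact: (mM _ _ _ _ (mM _ _ _ _ (mM _ _ _ _ (enorm_mod3 e) (enorm_mod3 f))
  (enorm_mod3 g)) (enorm_mod3 h)).
Qed.

(** * Every listed value is a determinant *)

(** In [p = X ^+ 2 + 3 * Y ^+ 2] the term [X] is even and [Y] odd. The sign of [X] fixes the residue
    modulo 3, that of [Y] the residue modulo 4. *)
Lemma prime7_norm p r : prime_mod12 7 p -> r = 1 \/ r = 3 -> exists u v : int,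
  [/\ (u %% 4)%Z = r, (v %% 4)%Z = 2, ((u + v) %% 3)%Z = 1 & enorm (u, v) = p].
Proof.
move=> [p_pr p7] r13.
have [||X0 [Y0 pXY]] := prime_sqr_3sqr p_pr; [lia|lia|].
have sX := sqrz_mod4 X0; have sY := sqrz_mod4 Y0.
have [X [XE X3]] : exists X, X ^+ 2 = X0 ^+ 2 /\ (X %% 3)%Z = 1.
  have X03 : ~~ (3 %| X0)%Z.
    by rewrite -(prime_dvdzX _ (isT : prime 3)); clear -pXY p7; lia.
  have [X1|X2] : (X0 %% 3)%Z = 1 \/ (X0 %% 3)%Z = 2 by clear -X03; lia.
    by exists X0.
  by exists (- X0); split; [rewrite sqrrN|clear -X2; lia].
have X2 : (X %% 2)%Z = 0 by have := sqrz_mod4 X; rewrite XE; clear -sX sY p7 pXY; lia.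
have Y2 : (Y0 %% 2)%Z = 1 by clear -sX sY p7 pXY; lia.
have [Y [YE Yr]] : exists Y, Y ^+ 2 = Y0 ^+ 2 /\ ((X + Y) %% 4)%Z = r.
  have [h|h] : ((X + Y0) %% 4)%Z = r \/ ((X - Y0) %% 4)%Z = r by clear -r13 X2 Y2; lia.
    by exists Y0.
  by exists (- Y0); rewrite sqrrN.
exists (X + Y), (2 * Y); split=> //.
- by have := sqrz_mod4 Y; rewrite YE; clear -sY Y2; lia.
- by clear -X3; lia.
- by rewrite pXY -XE -YE /enorm /=; ring.
Qed.

(* Witness: [1 + 2 w], a square root of -3, times an element of norm [p]. *)
Lemma norm_3prime7 p : prime_mod12 7 p -> exists u v : int,
  [/\ (u %% 4)%Z = 1, (4 %| v)%Z, (3 %| u + v)%Z & enorm (u, v) = 3 * p%:Z].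
Proof.
move=> p7; have [u [v [u1 v2 uv Np]]] := prime7_norm p7 (or_introl erefl).
exists (u - 2 * v), (2 * u - v); rewrite -Np.
by split; [clear -u1 v2; lia|clear -u1 v2; lia|clear; lia|rewrite /enorm /=; ring].
Qed.

(** Counterpart of [admissible_dvd_enorm], with the opposite sign: the element is 1 modulo 4 and -1
    modulo [1 - w]. *)
Lemma admissible_norm k : admissible_k k -> exists u v : int,
  [/\ (u %% 4)%Z = 1, (4 %| v)%Z, ((u + v) %% 3)%Z = 2 & enorm (u, v) = k].
Proof.
case=> [p1|[p [p_pr p5] ->]|[p [q [p7 q7 ->]]]].
- have [k_pr k1 _] := p1.
  have [|X [w [_ [_ [kX X3 _]]]]] := @eis_prime_factor k k%:Z 0 k_pr k1.
    by rewrite (_ : enorm (k%:Z, 0) = k%:Z * k%:Z) ?dvdz_mulr // /enorm /=; ring.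
  have Xw := (P1E k_pr k1 kX X3).1 p1.
  exists (- (X + 2 * w)), (- (4 * w)); rewrite kX.
  by split; [clear -Xw; lia|clear; lia|clear -X3; lia|rewrite /enorm /=; ring].
- exists p%:Z, 0; split; [lia|lia|lia|].
  by rewrite /enorm /= -mulnn PoszM; ring.
(* Modulo 4, [1 + 2 w] times [3 + 2 w] is -1; the witness is minus the product of the two
   elements. *)
have [u [v [u1 v2 uv Np]]] := prime7_norm p7 (or_introl erefl).
have [s [t [s1 t2 st Nq]]] := prime7_norm q7 (or_intror erefl).
have e1 : ((u * s) %% 4)%Z = 3 by apply: (modzM_eq u1 s1).
have e2 : ((v * t) %% 4)%Z = 0 by apply: (modzM_eq v2 t2).
have e3 : ((u * t) %% 4)%Z = 2 by apply: (modzM_eq u1 t2).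
have e4 : ((v * s) %% 4)%Z = 2 by apply: (modzM_eq v2 s1).
have e5 : (((u + v) * (s + t)) %% 3)%Z = 1 by apply: (modzM_eq uv st).
exists (v * t - u * s), (v * t - u * t - v * s); split.
- by move: e1 e2; clear; lia.
- by move: e2 e3 e4; clear; lia.
- have -> : v * t - u * s + (v * t - u * t - v * s) = 3 * (v * t) - (u + v) * (s + t) by ring.
  by move: e5; clear; lia.
- by rewrite PoszM -Np -Nq /enorm /=; ring.
Qed.

Ltac realize a b c d e f g h :=
  exists a, b, c, d, e, f, g, h;
  split; [split|split|split|split|]; rewrite /enorm /=; solve [lia | ring].

Lemma value_27_rep n : value_27 n -> Z6xZ2_rep n.
Proof.
case=> m [->|->|->].
- realize (3 * (1 - 4 * m)) (-1 : int) (1 : int) (1 : int)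
  ((3, 0) : eis) ((-1, 0) : eis) ((1, 0) : eis) ((1, 0) : eis).
- realize (2 * (3 * (2 * m - 1))) (2 : int) (-2 : int) (-2 : int)
  ((3, 0) : eis) ((-1, 0) : eis) ((1, 0) : eis) ((1, 0) : eis).
(* The halves must have an even sum, so the extra factor 4 sits in one entry for even [m] and is
   split over two for odd [m]. *)
have [m0|m1] : (m %% 2)%Z = 0 \/ (m %% 2)%Z = 1 by clear; lia.
  realize (2 * (3 * m)) (8 : int) (-2 : int) (-2 : int)
  ((3, 0) : eis) ((-1, 0) : eis) ((1, 0) : eis) ((1, 0) : eis).
realize (2 * (3 * m)) (2 : int) (4 : int) (4 : int)
  ((3, 0) : eis) ((-1, 0) : eis) ((1, 0) : eis) ((1, 0) : eis).
Qed.

Local Notation "[ 'e' a , b ]" := ((a, b) : eis) (at level 0).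

Lemma value_9p_rep n : value_9p n -> Z6xZ2_rep n.
Proof.
case=> m [p [/norm_3prime7[u [v [u1 v4 uv Np]]] [->|->|->]]].
- have -> : 3 ^+ 2 * (4 * m - 1) * p%:Z = 3 * (4 * m - 1) * enorm (u, v) by rewrite Np; ring.
  realize (3 * (4 * m - 1)) (1 : int) (1 : int) (1 : int) [e u, v] [e 1, 0] [e 1, 0] [e 1, 0].
- have -> : 2 ^+ 4 * 3 ^+ 2 * (2 * m - 1) * p%:Z = 2 ^+ 4 * 3 * (2 * m - 1) * enorm (u, v).
    by rewrite Np; ring.
  realize (2 * (3 * (1 - 2 * m))) (-2 : int) (-2 : int) (-2 : int)
    [e u, v] [e 1, 0] [e 1, 0] [e 1, 0].
have -> : 2 ^+ 6 * 3 ^+ 2 * m * p%:Z = 2 ^+ 6 * 3 * m * enorm (u, v) by rewrite Np; ring.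
have [m0|m1] : (m %% 2)%Z = 0 \/ (m %% 2)%Z = 1 by clear; lia.
  realize (2 * (3 * - m)) (-8 : int) (-2 : int) (-2 : int) [e u, v] [e 1, 0] [e 1, 0] [e 1, 0].
realize (2 * (3 * - m)) (-2 : int) (4 : int) (4 : int) [e u, v] [e 1, 0] [e 1, 0] [e 1, 0].
Qed.

Lemma value_9_rep n : value_9 n -> Z6xZ2_rep n.
Proof.
case=> m [->|->|->|->].
- realize (3 * (1 - 4 * m)) (-1 : int) (-1 : int) (-1 : int)
    [e 2, 4] [e 2, 0] [e 2, 0] [e 2, 0].
(* The halves are 1, [w], [w ^ 2] and 0 modulo 2, which sum to 0 there. The last has norm 4, which
   raises [2 ^+ 8] to [2 ^+ 10]. *)
- realize (3 * (4 * m - 1)) (-1 : int) (-1 : int) (1 : int)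
    [e 2, 4] [e 0, 2] [e -2, -2] [e 4, 0].
- realize (2 * (3 * (2 * m - 1))) (2 : int) (2 : int) (2 : int)
    [e 2, 4] [e 2, 0] [e 2, 0] [e 2, 0].
have [m0|m1] : (m %% 2)%Z = 0 \/ (m %% 2)%Z = 1 by clear; lia.
  realize (2 * (3 * m)) (8 : int) (2 : int) (2 : int) [e 2, 4] [e 2, 0] [e 2, 0] [e 2, 0].
realize (2 * (3 * m)) (2 : int) (-4 : int) (-4 : int) [e 2, 4] [e 2, 0] [e 2, 0] [e 2, 0].
Qed.

Lemma value_1_rep n : value_1 n -> Z6xZ2_rep n.
Proof.
case=> m [->|->|->].
- realize (12 * m + 1) (1 : int) (1 : int) (1 : int) [e 1, 0] [e 1, 0] [e 1, 0] [e 1, 0].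
- realize (- 2 * (6 * m + 1)) (-2 : int) (-2 : int) (-2 : int)
    [e 1, 0] [e 1, 0] [e 1, 0] [e 1, 0].
have [m0|m1] : (m %% 2)%Z = 0 \/ (m %% 2)%Z = 1 by clear; lia.
  realize (- 2 * (3 * m + 1)) (-2 : int) (4 : int) (4 : int)
    [e 1, 0] [e 1, 0] [e 1, 0] [e 1, 0].
realize (- 2 * (3 * m + 1)) (-8 : int) (-2 : int) (-2 : int)
  [e 1, 0] [e 1, 0] [e 1, 0] [e 1, 0].
Qed.

Lemma value_k_rep n : value_k n -> Z6xZ2_rep n.
Proof.
case=> m [k [/admissible_norm[u [v [u1 v4 uv Nk]]]]]; rewrite -Nk => -[->|->|->].
- realize (12 * m + 5) (1 : int) (1 : int) (1 : int) [e u, v] [e 1, 0] [e 1, 0] [e 1, 0].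
- realize (2 * (6 * m + 1)) (-2 : int) (-2 : int) (-2 : int)
    [e u, v] [e 1, 0] [e 1, 0] [e 1, 0].
have [m0|m1] : (m %% 2)%Z = 0 \/ (m %% 2)%Z = 1 by clear; lia.
  realize (2 * (3 * m + 1)) (-2 : int) (4 : int) (4 : int)
    [e u, v] [e 1, 0] [e 1, 0] [e 1, 0].
realize (2 * (3 * m + 1)) (-8 : int) (-2 : int) (-2 : int)
  [e u, v] [e 1, 0] [e 1, 0] [e 1, 0].
Qed.

Lemma value_2_rep n : value_2 n -> Z6xZ2_rep n.
Proof.
case=> m [->|->].
  realize (- (12 * m + 5)) (-1 : int) (-1 : int) (-1 : int)
    [e -2, 0] [e 2, 0] [e 2, 0] [e 2, 0].
realize (12 * m + 5) (-1 : int) (-1 : int) (1 : int) [e 2, 0] [e 0, 2] [e -2, -2] [e 4, 0].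
Qed.

Lemma value_2p_rep n : value_2p n -> Z6xZ2_rep n.
Proof.
case=> m [p [/prime7_norm/(_ (or_introl erefl))[u [v [u1 v2 uv Np]]]]].
rewrite -Np => -[->|->].
  realize (- (12 * m + 5)) (-1 : int) (-1 : int) (-1 : int)
    [e - 2 * u, - 2 * v] [e 2, 0] [e 2, 0] [e 2, 0].
realize (12 * m + 5) (-1 : int) (-1 : int) (1 : int)
  [e 2 * u, 2 * v] [e 0, 2] [e -2, -2] [e 4, 0].
Qed.

Lemma value_12_rep n : value_12 n -> Z6xZ2_rep n.
Proof.
case=> m [->|->].
  realize (- 2 * (6 * m + 1)) (2 : int) (2 : int) (2 : int)
    [e -2, 0] [e 2, 0] [e 2, 0] [e 2, 0].
have [m0|m1] : (m %% 2)%Z = 0 \/ (m %% 2)%Z = 1 by clear; lia.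
  realize (- 2 * (3 * m + 1)) (2 : int) (-4 : int) (-4 : int)
    [e -2, 0] [e 2, 0] [e 2, 0] [e 2, 0].
realize (- 2 * (3 * m + 1)) (8 : int) (2 : int) (2 : int)
  [e -2, 0] [e 2, 0] [e 2, 0] [e 2, 0].
Qed.

Local Open Scope classical_set_scope.
Local Open Scope ring_scope.

Theorem theorem5p2 :
  group_det_values Z6xZ2 =
  [set n : int | exists m : int,
     [\/ n = 3 ^+ 3 * (4 * m - 1),
         n = 2 ^+ 4 * 3 ^+ 3 * (2 * m - 1)
       | n = 2 ^+ 6 * 3 ^+ 3 * m]]
  `|` [set n : int | exists (m : int) (p : nat), prime_mod12 7 p /\
     [\/ n = 3 ^+ 2 * (4 * m - 1) * p%:Z,
         n = 2 ^+ 4 * 3 ^+ 2 * (2 * m - 1) * p%:Z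
       | n = 2 ^+ 6 * 3 ^+ 2 * m * p%:Z]]
  `|` [set n : int | exists m : int,
     [\/ n = 2 ^+ 8 * 3 ^+ 2 * (4 * m - 1),
         n = 2 ^+ 10 * 3 ^+ 2 * (4 * m - 1),
         n = 2 ^+ 12 * 3 ^+ 2 * (2 * m - 1)
       | n = 2 ^+ 14 * 3 ^+ 2 * m]]
  `|` [set n : int | exists m : int,
     [\/ n = 12 * m + 1,
         n = 2 ^+ 4 * (6 * m + 1)
       | n = 2 ^+ 6 * (3 * m + 1)]]
  `|` [set n : int | exists (m : int) (k : nat), admissible_k k /\
     [\/ n = (12 * m + 5) * k%:Z,
         n = - 2 ^+ 4 * (6 * m + 1) * k%:Z
       | n = - 2 ^+ 6 * (3 * m + 1) * k%:Z]]
  `|` [set n : int | exists m : int,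
     n = 2 ^+ 8 * (12 * m + 5) \/ n = 2 ^+ 10 * (12 * m + 5)]
  `|` [set n : int | exists (m : int) (p : nat), prime_mod12 7 p /\
     (n = 2 ^+ 8 * (12 * m + 5) * p%:Z \/ n = 2 ^+ 10 * (12 * m + 5) * p%:Z)]
  `|` [set n : int | exists m : int,
     n = - 2 ^+ 12 * (6 * m + 1) \/ n = - 2 ^+ 14 * (3 * m + 1)].
Proof.
apply/seteqP; split=> n.
  by move/group_det_values_Z6xZ2/rep_values.
move=> h; apply/group_det_values_Z6xZ2; case: h => [[[[[[[h|h]|h]|h]|h]|h]|h]|h].
- exact: value_27_rep.
- exact: value_9p_rep.
- exact: value_9_rep.
- exact: value_1_rep.
- exact: value_k_rep.
- exact: value_2_rep.
- exact: value_2p_rep.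
- exact: value_12_rep.
Qed.
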